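(* Let $\mathcal{N}\subseteq\{2,3,\dots\}$ be infinite, and for each $n\in\mathcal{N}$ let $p=p(n)\in(0,1)$ be such that $np$ is not an integer and $n\lfloor np\rfloor$ is even. For each $n\in\mathcal N$ let $R=R_n$ be an arbitrary Fréchet mean of $G_{n,p}$ (equivalently, an arbitrary $\lfloor np\rfloor$-regular graph on $[n]$), and let $F_n=d_{\mathrm F}(G_{n,p},R)$. All limits are as $n\to\infty$ within $\mathcal N$. (i) If $np(1-p)\to0$ and $n^2p(1-p)\to\infty$, then $$F_n-\sqrt{\mathbb{E}[F_n^2]}\xrightarrow{D}N(0,1).$$ (ii) If $np(1-p)\to c$ for some non-integer constant $c>0$, then $$F_n-\sqrt{\mathbb{E}[F_n^2]}\xrightarrow{D}N\left(0,\ \frac{c\big[4(c-\lfloor c\rfloor+1)^2+c\big]}{2\big[(c-\lfloor c\rfloor)^2+\lfloor c\rfloor+2c\big]}\right).$$ (iii) If $np(1-p)\to\infty$, then $$\frac{F_n-\sqrt{\mathbb{E}[F_n^2]}}{\sqrt{np(1-p)}}\xrightarrow{D}N\Big(0,\frac16\Big).$$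
   Context: $[n]=\{1,\dots,n\}$. $\mathcal{G}_n$ is the set of all simple graphs with vertex set $[n]$. For $G\in\mathcal{G}_n$ with adjacency matrix $A$ and diagonal degree matrix $D$, the Laplacian is $L=D-A$. The Frobenius distance between $G,G'\in\mathcal{G}_n$ with Laplacians $L,L'$ is $d_{\mathrm F}(G,G')=\|L-L'\|_{\mathrm F}=\big(\sum_{i,j\in[n]}(l_{ij}-l'_{ij})^2\big)^{1/2}$. $G_{n,p}$ is the Erdős–Rényi random graph on $[n]$: each possible edge is present independently with probability $p$. A Fréchet mean of $G_{n,p}$ is any minimizer over $G\in\mathcal{G}_n$ of $f(G)=\mathbb{E}[d_{\mathrm F}^2(G,G_{n,p})]$; when $np$ is not an integer and $n\lfloor np\rfloor$ is even, the Fréchet means are exactly the $\lfloor np\rfloor$-regular graphs on $[n]$. $\lfloor x\rfloor$ is the floor of $x$. $\xrightarrow{D}$ denotes convergence in distribution and $N(0,v)$ is the normal law with mean $0$ and variance $v$. *)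

(* Defs.v *)
From HB Require Import structures.
From mathcomp Require Import all_boot all_order all_algebra.
From mathcomp Require Import all_classical all_reals all_analysis.

Set Implicit Arguments.
Unset Strict Implicit.
Unset Printing Implicit Defensive.

Import Order.TTheory GRing.Theory Num.Theory.
Import numFieldNormedType.Exports.

Local Open Scope classical_set_scope.
Local Open Scope ring_scope.

Definition is_adjacency n (A : 'M[bool]_n) : bool :=
  [forall i, ~~ A i i] && [forall i, forall j, A i j == A j i].

(* A simple graph on the vertex set 'I_n, represented by its boolean adjacency
   matrix, so that equality is equality of labelled graphs. *)
Record sgraph (n : nat) := SGraph {
  sgraph_adj :> 'M[bool]_n;
  sgraph_adjP : is_adjacency sgraph_adj
}.

HB.instance Definition _ n := [isSub for @sgraph_adj n].
HB.instance Definition _ n := [Finite of sgraph n by <:].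

Lemma empty_adjacency n : is_adjacency (const_mx false : 'M[bool]_n).
Proof.
apply/andP; split; apply/forallP => i; first by rewrite mxE.
by apply/forallP => j; rewrite !mxE.
Qed.

Definition empty_sgraph n : sgraph n := SGraph (empty_adjacency n).

HB.instance Definition _ n := isPointed.Build (sgraph n) (empty_sgraph n).
HB.instance Definition _ n := @isMeasurable.Build default_measure_display
  (sgraph n) discrete_measurable discrete_measurable0
  discrete_measurableC discrete_measurableU.

Section laplacian.
Context {R : realType} {n : nat}.
Implicit Types G H : sgraph n.

Definition adjacency G : 'M[R]_n := \matrix_(i, j) (G i j)%:R.

Definition degree G (i : 'I_n) : nat := #|[set j | G i j]%SET|.

Definition laplacian G : 'M[R]_n :=
  diag_mx (\row_i (degree G i)%:R) - adjacency G.

Definition frob_dist G H : R :=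
  Num.sqrt (\sum_i \sum_j (laplacian G i j - laplacian H i j) ^+ 2).

Definition frechet_mean (P : probability (sgraph n) R) G : Prop :=
  forall H, ('E_P[fun K => (frob_dist G K ^+ 2)%R]
             <= 'E_P[fun K => (frob_dist H K ^+ 2)%R])%E.

End laplacian.

Section gnp.
Context {R : realType} (n : nat) (p : R).

Definition gnp_pmf (G : sgraph n) : R :=
  \prod_(e : 'I_n * 'I_n | (e.1 < e.2)%N) bernoulli_pmf p (G e.1 e.2).

Lemma gnp_pmf_ge0 G : 0 <= p <= 1 -> 0 <= gnp_pmf G.
Proof. by move=> p01; apply: prodr_ge0 => e _; exact: bernoulli_pmf_ge0. Qed.

Lemma sum_gnp_pmf : \sum_G gnp_pmf G = 1.
Proof.
pose D : {pred 'I_n * 'I_n} := [pred e : 'I_n * 'I_n | (e.1 < e.2)%N].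
pose E := {e | e \in D}.
pose low (f : {ffun E -> bool}) (i j : 'I_n) : bool :=
  if insub (i, j) is Some e then f e else false.
pose A f : 'M[bool]_n := \matrix_(i, j) (low f i j || low f j i).
have lowP f : forall i j, low f i j -> (i < j)%N.
  by move=> i j; rewrite /low; case: insubP => [[e he] /= _ ee _|//]; move: he; rewrite ee.
have AP f : is_adjacency (A f).
  apply/andP; split; apply/forallP => i.
    by rewrite mxE orbb; apply/negP => /lowP; rewrite ltnn.
  by apply/forallP => j; rewrite !mxE orbC.
pose g f : sgraph n := SGraph (AP f).
pose h (G : sgraph n) : {ffun E -> bool} :=
  [ffun e => G (sval e).1 (sval e).2].
have gE f (e : E) : g f (sval e).1 (sval e).2 = f e.
  rewrite /= mxE; case: e => -[i j] /= ij.
  have -> : low f j i = false by apply/negP => /lowP ji; rewrite ltnNge ltnW in ji.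
  by rewrite orbF /low; case: insubP => [e _ ee|/negP//]; congr (f _); apply: val_inj.
have hK : cancel g h by move=> f; apply/ffunP => e; rewrite ffunE gE.
have gK : cancel h g.
  move=> G; apply: val_inj; apply/matrixP => i j.
  have /andP[/forallP G0 /forallP GS] := sgraph_adjP G.
  have lowh k l : low (h G) k l = (k < l)%N && G k l.
    rewrite -[(k < l)%N]/((k, l) \in D) /low.
    by case: insubP => [e -> ee|/negbTE -> //]; rewrite ffunE ee.
  rewrite /= mxE !lowh; have /forallP/(_ j)/eqP := GS i; rewrite -/(G i j) => <-.
  by case: ltngtP => [||/val_inj ->] //=; rewrite ?orbF // (negbTE (G0 j)).
rewrite (reindex g) /=; last by exists h => ? _; [exact: hK | exact: gK].
transitivity (\sum_(f : {ffun E -> bool}) \prod_(e : E) bernoulli_pmf p (f e)).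
  apply: eq_bigr => f _; rewrite /gnp_pmf.
  rewrite [RHS](eq_bigr (fun e : E =>
    bernoulli_pmf p (g f (sval e).1 (sval e).2))); last by move=> e _; rewrite gE.
  by rewrite -(big_sub D (fun e => bernoulli_pmf p (g f e.1 e.2))).
rewrite -(bigA_distr_bigA (fun (_ : E) b => bernoulli_pmf p b)).
by apply: big1 => e _; rewrite big_bool /= /bernoulli_pmf addrC subrK.
Qed.

(* Each of the pairs i < j is an edge independently with probability p.  As for
   [bernoulli_prob], the value when p lies outside [0, 1] is a dummy. *)
Definition gnp : set (sgraph n) -> \bar R := fun A =>
  if 0 <= p <= 1 then (\sum_(G \in A) (gnp_pmf G)%:E)%E
  else \d_(empty_sgraph n) A.

Let gnp0 : gnp set0 = 0%E.
Proof. by rewrite /gnp; case: ifPn => // p01; rewrite fsbig_set0. Qed.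

Let gnp_ge0 A : (0 <= gnp A)%E.
Proof.
rewrite /gnp; case: ifPn => // p01; rewrite fsbig_finite//= sumEFin lee_fin.
by apply: sumr_ge0 => /= b _; exact: gnp_pmf_ge0.
Qed.

Let gnp_sigma_additive : semi_sigma_additive gnp.
Proof.
move=> F mF tF mUF; rewrite /gnp; case: ifPn => p01; last first.
  exact: measure_semi_sigma_additive.
apply: cvg_toP.
  apply: ereal_nondecreasing_is_cvgn => m k mk.
  apply: lee_sum_nneg_natr => // l _ _.
  rewrite fsbig_finite//= sumEFin lee_fin.
  by apply: sumr_ge0 => /= b _; exact: gnp_pmf_ge0.
transitivity (\sum_(0 <= i <oo) (\esum_(j in F i) (gnp_pmf j)%:E))%E.
  apply: eq_eseriesr => k _; rewrite esum_fset//= => b _.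
  by rewrite lee_fin gnp_pmf_ge0.
rewrite -nneseries_sum_bigcup//=; last first.
  by move=> b; rewrite lee_fin gnp_pmf_ge0.
by rewrite esum_fset//= => b _; rewrite lee_fin gnp_pmf_ge0.
Qed.

HB.instance Definition _ := isMeasure.Build _ _ _ gnp
  gnp0 gnp_ge0 gnp_sigma_additive.

Let gnp_setT : gnp [set: _] = 1%E.
Proof.
rewrite /gnp; case: ifPn => p01; last by rewrite diracT.
have E := @fsbigE _ _ _ _ _ _ (fun G => (gnp_pmf G)%:E)
  (index_enum_uniq (sgraph n)).
rewrite (E _ _ setT) => [|//|G _]; last by rewrite mem_index_enum.
rewrite (eq_bigl xpredT) => [|G]; last by rewrite in_setT.
by rewrite sumEFin sum_gnp_pmf.
Qed.

HB.instance Definition _ :=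
  @Measure_isProbability.Build _ _ R gnp gnp_setT.

End gnp.
Arguments gnp {R} n p _.

Section sgraph_rv.
Context {R : realType} (n : nat) (f : sgraph n -> R).

(* Every real function on the finite space of graphs is a random variable. *)
Definition sgraph_rv : sgraph n -> R := f.

Let measurable_sgraph_rv : measurable_fun setT sgraph_rv.
Proof. by []. Qed.

HB.instance Definition _ := isMeasurableFun.Build _ _ _ _
  sgraph_rv measurable_sgraph_rv.

End sgraph_rv.

(* X_n converges in distribution to nu as n tends to infinity within N: the
   cdfs converge at every continuity point of the cdf of nu. *)
Definition cvg_in_distribution d (R : realType) (T : nat -> measurableType d)
    (P : forall n, probability (T n) R) (N : set nat)
    (X : forall n, {RV P n >-> R})
    (nu : probability (measurableTypeR R) R) : Prop :=
  forall x : R, {for x, continuous (fun t : R => nu `]-oo, t]%classic)} ->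
    cdf (X n) x @[n --> within N \oo] --> nu `]-oo, x]%classic.

(* Main.v *)
(** The squared distance to a d-regular graph is a quadratic polynomial in the
    centered edge indicators x_e:
      F^2 - E F^2 = \sum_e b_e x_e + \sum_(e <> f) |e n f| x_e x_f,
    and a Fréchet mean is d-regular with d = floor (np), because E F^2 is a sum
    over the vertices of a quadratic function of the degree which, among the
    integers, is smallest at d alone (and a circulant graph attains it).
    Up to the normalization k = (2 tau sqrt(E F^2))^-1, the event
    F - sqrt(E F^2) <= x tau is the event k (F^2 - E F^2) <= x + o(1), so it
    suffices to prove a central limit theorem for P = k (F^2 - E F^2).

    This is done by Stein's method. Integration by parts for Bernoulli variables,
    E[x_e H] = p(1-p) E[D_e H], turns E[P f(P)] into E[f'(P) Gamma] up to
    third moments of D_e P, where Gamma is the carré du champ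
    p(1-p) \sum_e (b_e + L_e/2) (b_e + L_e), with b_e + L_e = D_e P. Its variance is
    again that of a quadratic polynomial, governed by the number of edges meeting
    two given edges. All errors are O(n^{-1/2} + (n^2 p (1-p))^{-1/2}) in the
    three regimes at once, which differ only in the asymptotics of E F^2 and
    Var F^2. *)
From HB Require Import structures.
Require Import Defs.
From mathcomp Require Import all_boot all_order all_algebra.
From mathcomp Require Import zify ring lra.
From mathcomp Require Import all_classical all_reals all_analysis.
From mathcomp Require Import measurable_realfun.

Set Implicit Arguments.
Unset Strict Implicit.
Unset Printing Implicit Defensive.

Import Order.TTheory GRing.Theory Num.Theory.
Import numFieldNormedType.Exports.

Local Open Scope classical_set_scope.
Local Open Scope ring_scope.

(** * Product Bernoulli measure on the cube *)

(** The method needs test functions f with bounded f' and a quadratic Taylor remainder, and the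
    Stein solution of an indicator has a jump in f'. The cdf is therefore squeezed between two
    logistic functions. Convergence is wanted at one continuity point at a time, so two of them
    suffice, and the bounds on their Stein solutions are fixed before n varies.

    Write s = p(1-p). The coefficient b_e is O(k) and L_e fluctuates by k sqrt(ns), so D_e P has
    size k sqrt(1+ns); summing its square with weight s over about n^2/2 edges gives the scale rho^2
    = k^2 n^2 s (1+ns). Both error terms are powers of rho times a vanishing rate. Boundedness of
    rho is a lower bound of order n^2 s (1+ns) on tau^2 E F^2, which each regime supplies along with
    its limits.

    The asymptotic hypotheses see only p(1-p), so p may be near 0, near 1, or alternate between the
    two. The central limit theorem is proved with p itself, while all limits are computed with q =
    min(p, 1-p). *)

Section bernoulli_product.
Context {R : realType} {E : finType} (p : R).
Local Notation cube := {ffun E -> bool}.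
Implicit Types (w : cube) (e f g : E) (H : cube -> R).

Definition bprod w : R := \prod_e bernoulli_pmf p (w e).

Definition bexp H : R := \sum_w bprod w * H w.

Definition setc w e b : cube := [ffun f => if f == e then b else w f].

Definition disc e H w : R := H (setc w e true) - H (setc w e false).

Definition cent w e : R := (w e)%:R - p.

Lemma setc_setc w e b c : setc (setc w e b) e c = setc w e c.
Proof. by apply/ffunP => f; rewrite !ffunE; case: eqP. Qed.

Lemma setc_id w e : setc w e (w e) = w.
Proof. by apply/ffunP => f; rewrite !ffunE; case: eqP => // ->. Qed.

Lemma eq_bexp H1 H2 : H1 =1 H2 -> bexp H1 = bexp H2.
Proof. by move=> H12; apply: eq_bigr => w _; rewrite H12. Qed.

Lemma bexpD H1 H2 : bexp (fun w => H1 w + H2 w) = bexp H1 + bexp H2.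
Proof. by rewrite -big_split; apply: eq_bigr => w _ /=; rewrite mulrDr. Qed.

Lemma bexpZ c H : bexp (fun w => c * H w) = c * bexp H.
Proof. by rewrite mulr_sumr; apply: eq_bigr => w _; rewrite mulrCA. Qed.

Lemma bexp_sum (I : finType) (H : I -> cube -> R) :
  bexp (fun w => \sum_i H i w) = \sum_i bexp (H i).
Proof.
by rewrite exchange_big /=; apply: eq_bigr => w _; rewrite mulr_sumr.
Qed.

Lemma sum_bprod : \sum_w bprod w = 1.
Proof.
rewrite -(bigA_distr_bigA (fun (_ : E) b => bernoulli_pmf p b)).
by apply: big1 => e _; rewrite big_bool /= /bernoulli_pmf addrC subrK.
Qed.

Lemma bexp_cst c : bexp (fun=> c) = c.
Proof. by rewrite /bexp -mulr_suml sum_bprod mul1r. Qed.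

(** Flipping the coordinate [e] pairs up the configurations. A pair is indexed by its member with
    [w e], and the weight at [e] is summed out by hand. *)
Lemma bexp_split H e :
  bexp H = \sum_(w : cube | w e) (\prod_(f | f != e) bernoulli_pmf p (w f)) *
     (p * H (setc w e true) + (1 - p) * H (setc w e false)).
Proof.
pose sw w := setc w e (~~ w e).
have swK : involutive sw.
  move=> w; rewrite /sw setc_setc -[RHS](setc_id w e); congr setc.
  by rewrite !ffunE eqxx negbK.
rewrite /bexp (bigID (fun w : cube => w e)) /=.
rewrite [X in _ + X](reindex sw) /=; last by exists sw => ? _; exact: swK.
rewrite [X in _ + X = _](eq_bigl (fun w : cube => w e)) => [|w]; last first.
  by rewrite ffunE eqxx negbK.
rewrite -big_split; apply: eq_bigr => w we /=.
have E1 : setc w e true = w by rewrite -[RHS](setc_id w e) we.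
have E2 : sw w = setc w e false by rewrite /sw we.
rewrite E1 E2 /bprod (bigD1 e) //= [X in _ + X * _ = _](bigD1 e) //= we.
rewrite ffunE eqxx /= [X in _ + _ * X * _ = _](eq_bigr (fun f =>
  bernoulli_pmf p (w f))); last first.
  by move=> f fe; rewrite ffunE (negbTE fe).
by rewrite mulrDr; congr (_ + _); rewrite -mulrA mulrCA.
Qed.

(** On each such pair the values [1 - p] and [- p] of the centered variable meet the weights [p] and
    [1 - p], so both products are [p * (1 - p)] up to sign. *)
Lemma bexp_cent e H :
  bexp (fun w => cent w e * H w) = p * (1 - p) * bexp (disc e H).
Proof.
rewrite (bexp_split _ e) (bexp_split (disc e H) e) mulr_sumr.
apply: eq_bigr => w we; rewrite /disc !setc_setc /cent !ffunE eqxx /=.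
by ring.
Qed.

Hypothesis p01 : 0 <= p <= 1.

Let p0 : 0 <= p. Proof. by case/andP: p01. Qed.
Let p1 : p <= 1. Proof. by case/andP: p01. Qed.

Lemma bprod_ge0 w : 0 <= bprod w.
Proof. by apply: prodr_ge0 => e _; exact: bernoulli_pmf_ge0. Qed.

Lemma le_bexp H1 H2 : (forall w, H1 w <= H2 w) -> bexp H1 <= bexp H2.
Proof.
by move=> H12; apply: ler_sum => w _; rewrite ler_wpM2l ?bprod_ge0.
Qed.

Lemma bexp_ge0 H : (forall w, 0 <= H w) -> 0 <= bexp H.
Proof. by move=> H0; apply: sumr_ge0 => w _; rewrite mulr_ge0 ?bprod_ge0. Qed.

Lemma ler_norm_bexp H : `|bexp H| <= bexp (fun w => `|H w|).
Proof.
apply: le_trans (ler_norm_sum _ _ _) _; apply: ler_sum => w _.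
by rewrite normrM ger0_norm ?bprod_ge0.
Qed.

(** The difference of the squares is the variance of [|H|]. *)
Lemma bexp_norm_le_sqrt H :
  bexp (fun w => `|H w|) <= Num.sqrt (bexp (fun w => H w ^+ 2)).
Proof.
set m := bexp (fun w => `|H w|).
have m0 : 0 <= m by apply: bexp_ge0.
rewrite -(ger0_norm m0) -sqrtr_sqr ler_wsqrtr // -subr_ge0.
have -> : bexp (fun w => H w ^+ 2) - m ^+ 2 = bexp (fun w => (`|H w| - m) ^+ 2).
  transitivity (bexp (fun w => H w ^+ 2 + (- (2 * m) * `|H w| + m ^+ 2))).
    by rewrite !bexpD bexpZ bexp_cst -/m; ring.
  apply: eq_bexp => w; rewrite sqrrB real_normK ?num_real // -mulr_natl.
  by ring.
by apply: bexp_ge0 => w; rewrite sqr_ge0.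
Qed.

Local Notation s2 := (p * (1 - p)).

Let s2_ge0 : 0 <= s2. Proof. by rewrite mulr_ge0 // subr_ge0. Qed.

Definition linf (c : E -> R) w : R := \sum_e c e * cent w e.

Lemma cent_setc w e b f :
  cent (setc w e b) f = cent w f + (f == e)%:R * (b%:R - (w e)%:R).
Proof.
by rewrite /cent ffunE; case: eqP => [->|_] /=; rewrite ?mul1r ?mul0r; ring.
Qed.

Lemma linf_setc c w e b :
  linf c (setc w e b) = linf c w + c e * (b%:R - (w e)%:R).
Proof.
rewrite /linf; under eq_bigr do rewrite cent_setc mulrDr.
rewrite big_split /=; congr (_ + _).
rewrite (bigD1 e) //= eqxx mul1r big1 ?addr0 // => f /negbTE ->.
by rewrite mul0r mulr0.
Qed.

Lemma disc_linf c e w : disc e (linf c) w = c e.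
Proof. by rewrite /disc !linf_setc /=; ring. Qed.

Lemma bexp_linfM c H :
  bexp (fun w => linf c w * H w) = s2 * \sum_e c e * bexp (disc e H).
Proof.
under eq_bexp do rewrite mulr_suml.
rewrite bexp_sum mulr_sumr; apply: eq_bigr => e _.
under eq_bexp do rewrite -mulrA.
by rewrite bexpZ bexp_cent mulrCA.
Qed.

Lemma bexp_linf c : bexp (linf c) = 0.
Proof.
under eq_bexp do rewrite -[linf c _]mulr1.
rewrite bexp_linfM big1 ?mulr0 // => e _.
by rewrite /disc; under eq_bexp do rewrite subrr; rewrite bexp_cst mulr0.
Qed.

Lemma bexp_linf2 c : bexp (fun w => linf c w ^+ 2) = s2 * \sum_e c e ^+ 2.
Proof.
under eq_bexp do rewrite expr2.
rewrite bexp_linfM; congr (_ * _); apply: eq_bigr => e _.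
by under eq_bexp do rewrite disc_linf; rewrite bexp_cst.
Qed.

(** With t = [c e] and L = [linf c w], integration by parts leaves 3 t^2 L^2 + 3 t^3 L + t^4 or 3
    t^2 L^2 - 3 t^3 L + t^4, according to the state of [e]. AM-GM on the cross term costs another
    3/2 of t^2 L^2, whence 9/2 in place of the Gaussian constant 3. *)
Lemma bexp_linf4 c : bexp (fun w => linf c w ^+ 4) <=
  9 / 2 * (s2 * \sum_e c e ^+ 2) ^+ 2 + 3 * s2 * \sum_e c e ^+ 4.
Proof.
under eq_bexp do rewrite exprS.
rewrite bexp_linfM -(bexp_linf2 c); set V := bexp _.
suff le_e e : c e * bexp (disc e (fun w => linf c w ^+ 3)) <=
    c e ^+ 2 * (9 / 2 * V) + 3 * c e ^+ 4.
  apply: (@le_trans _ _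
    (s2 * \sum_e (c e ^+ 2 * (9 / 2 * V) + 3 * c e ^+ 4))).
    by apply: ler_wpM2l => //; apply: ler_sum.
  rewrite big_split /= -mulr_suml -mulr_sumr [V in leRHS]bexp_linf2.
  by rewrite /V bexp_linf2; lra.
rewrite -bexpZ (_ : _ + _ = bexp (fun w =>
    c e ^+ 2 * (9 / 2) * linf c w ^+ 2 + 3 * c e ^+ 4)); last first.
  by rewrite bexpD bexp_cst bexpZ mulrA.
apply: le_bexp => w; rewrite /disc !linf_setc.
set L := linf c w; set t := c e.
suff : (t * ((L + t * (true%:R - (w e)%:R)) ^+ 3 -
  (L + t * (false%:R - (w e)%:R)) ^+ 3)) <= t ^+ 2 * (9 / 2 * L ^+ 2) + 3 * t ^+ 4.
  by rewrite mulrA.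
have H0 : 0 <= t ^+ 2 * (L - t) ^+ 2 by rewrite mulr_ge0 // sqr_ge0.
have H1 : 0 <= t ^+ 2 * (L + t) ^+ 2 by rewrite mulr_ge0 // sqr_ge0.
have H2 : 0 <= t ^+ 2 * L ^+ 2 by rewrite mulr_ge0 // sqr_ge0.
have H3 : 0 <= t ^+ 2 * t ^+ 2 by rewrite mulr_ge0 // sqr_ge0.
by case: (w e) => /=; nra.
Qed.

End bernoulli_product.

(** * Quadratic forms in centered Bernoulli variables *)

Section quadratic_form.
Context {R : realType} {E : finType} (p : R).
Local Notation cube := {ffun E -> bool}.
Implicit Types (w : cube) (e f g : E) (H : cube -> R).
Local Notation s2 := (p * (1 - p)).
Local Notation bexp := (bexp p).
Local Notation linf := (linf p).
Local Notation cent := (cent p).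

(** The factor 1/2 offsets the double count of unordered pairs, so that for symmetric [a] with zero
    diagonal the derivative in direction [e] is [b e + linf (a e)]. *)
Definition quad (b : E -> R) (a : E -> E -> R) w : R :=
  linf b w + 2^-1 * \sum_e cent w e * linf (a e) w.

Definition quad_var (b : E -> R) (a : E -> E -> R) : R :=
  s2 * \sum_e b e ^+ 2 + 2^-1 * s2 ^+ 2 * \sum_e \sum_f a e f ^+ 2.

Variables (b : E -> R) (a : E -> E -> R).
Hypothesis a_sym : forall e f, a e f = a f e.
Hypothesis a_diag : forall e, a e e = 0.

Lemma linf_rowC w e : linf (a e) w = \sum_f cent w f * a f e.
Proof. by apply: eq_bigr => f _; rewrite mulrC a_sym. Qed.

Lemma quad_setc w e c : quad b a (setc w e c) =
  quad b a w + (c%:R - (w e)%:R) * (b e + linf (a e) w).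
Proof.
rewrite /quad linf_setc; set t := c%:R - _.
have -> : \sum_f cent (setc w e c) f * linf (a f) (setc w e c) =
    \sum_f cent w f * linf (a f) w + 2 * (t * linf (a e) w).
  transitivity (\sum_f (cent w f * linf (a f) w + t * (cent w f * a f e) +
      (f == e)%:R * (t * (linf (a f) w + t * a f e)))).
    by apply: eq_bigr => f _; rewrite cent_setc linf_setc -/t; ring.
  rewrite 2!big_split /= -mulr_sumr -linf_rowC [X in _ + X](bigD1 e) //=.
  rewrite eqxx a_diag [X in _ + (_ + X)]big1 => [|f /negbTE ->].
    by rewrite /=; ring.
  by rewrite mul0r.
by field.
Qed.

Lemma disc_quad e w : disc e (quad b a) w = b e + linf (a e) w.
Proof. by rewrite /disc !quad_setc /=; ring. Qed.

(** Integrating [cent w e] by parts against [linf (a e) w * H w] differentiates [H] alone, because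
    [a e e = 0] makes [linf (a e)] independent of the coordinate [e]. Only one factor of each
    product is integrated, so the 1/2 survives. *)
Lemma bexp_quadM H : bexp (fun w => quad b a w * H w) =
  s2 * \sum_e bexp (fun w => (b e + 2^-1 * linf (a e) w) * disc e H w).
Proof.
rewrite /quad; under eq_bexp do rewrite mulrDl.
rewrite bexpD bexp_linfM.
under [X in _ + X]eq_bexp do rewrite -mulrA mulr_suml.
rewrite bexpZ bexp_sum.
under [X in _ + _ * X]eq_bigr => e _.
  under eq_bexp do rewrite -mulrA.
  rewrite bexp_cent; over.
rewrite -mulr_sumr mulrCA -mulrDr mulr_sumr -big_split; congr (_ * _).
apply: eq_bigr => e _ /=.
under [RHS]eq_bexp do rewrite mulrDl -mulrA.
rewrite [RHS]bexpD [X in _ = X + _]bexpZ [X in _ = _ + X]bexpZ; congr (_ + _ * _).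
apply: eq_bexp => w; rewrite /disc !linf_setc a_diag !mul0r !addr0.
by rewrite mulrBr.
Qed.

Lemma bexp_quad : bexp (quad b a) = 0.
Proof.
under eq_bexp do rewrite -[quad _ _ _]mulr1.
rewrite bexp_quadM big1 ?mulr0 // => e _.
by under eq_bexp do rewrite /disc subrr mulr0; rewrite bexp_cst.
Qed.

(* The operator Gamma(P, -L^-1 P) of the Malliavin-Stein method: inverting the
   generator weights the quadratic part of D_e P by 1/2. *)
Definition carre_du_champ w : R :=
  s2 * \sum_e (b e + 2^-1 * linf (a e) w) * (b e + linf (a e) w).

Lemma bexp_carre : bexp carre_du_champ = quad_var b a.
Proof.
rewrite bexpZ bexp_sum /quad_var.
under eq_bigr => e _.
  rewrite (_ : bexp _ = b e ^+ 2 + 2^-1 * s2 * \sum_f a e f ^+ 2); first over.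
  transitivity (bexp (fun w => b e ^+ 2 + (3 / 2 * b e * linf (a e) w +
     2^-1 * linf (a e) w ^+ 2))).
    by apply: eq_bexp => w; field.
  by rewrite !bexpD !bexpZ bexp_cst bexp_linf bexp_linf2; ring.
by rewrite big_split /= -mulr_sumr; ring.
Qed.

Lemma bexp_quad2 : bexp (fun w => quad b a w ^+ 2) = quad_var b a.
Proof.
under eq_bexp do rewrite expr2.
rewrite bexp_quadM -bexp_carre bexpZ bexp_sum; congr (_ * _).
by apply: eq_bigr => e _; apply: eq_bexp => w; rewrite disc_quad.
Qed.

(** [carre_lin] and [carre_quad] are the coefficients of the centered carré du champ, itself a
    quadratic form. The 3/2 comes from (b + L/2)(b + L), and the term with [1 - 2 * p] from the
    diagonal squares, since x_f^2 = (1-2p) x_f + p(1-p). *)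
Definition carre_lin f : R := s2 * (3 / 2 * (\sum_e a e f * b e) +
  2^-1 * (1 - 2 * p) * \sum_e a e f ^+ 2).

Definition carre_quad f g : R :=
  if f == g then 0 else s2 * \sum_e a e f * a e g.

Lemma carre_quadE w :
  carre_du_champ w = quad_var b a + quad carre_lin carre_quad w.
Proof.
pose B f g := \sum_e a e f * a e g.
have sqr_cent f : cent w f ^+ 2 = (1 - 2 * p) * cent w f + s2.
  by rewrite /cent; case: (w f) => /=; ring.
have E1 : \sum_e linf (a e) w ^+ 2 =
    \sum_f cent w f ^+ 2 * B f f +
    \sum_f cent w f * \sum_g (if f == g then 0 else B f g) * cent w g.
  transitivity (\sum_f \sum_g cent w f * cent w g * B f g).
    rewrite exchange_big /=.
    under [RHS]eq_bigr do under eq_bigr do rewrite mulr_sumr.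
    under [RHS]eq_bigr do rewrite exchange_big.
    rewrite [RHS]exchange_big; apply: eq_bigr => e _ /=.
    rewrite expr2 /linf mulr_suml; apply: eq_bigr => f _.
    by rewrite mulr_sumr; apply: eq_bigr => g _; ring.
  rewrite -big_split; apply: eq_bigr => f _ /=.
  rewrite (bigD1 f) //= [in RHS](bigD1 f) //= eqxx mul0r add0r expr2.
  congr (_ + _); rewrite mulr_sumr; apply: eq_bigr => g.
  by rewrite eq_sym => /negbTE ->; ring.
have E2 : \sum_e b e * linf (a e) w = \sum_f (\sum_e a e f * b e) * cent w f.
  under eq_bigr do rewrite mulr_sumr.
  rewrite exchange_big; apply: eq_bigr => f _ /=.
  by rewrite mulr_suml; apply: eq_bigr => e _; ring.
have E3 : \sum_f B f f = \sum_e \sum_f a e f ^+ 2.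
  by rewrite exchange_big; apply: eq_bigr => f _; apply: eq_bigr => e _; rewrite expr2.
have -> : carre_du_champ w = s2 * (\sum_e b e ^+ 2 +
   3 / 2 * (\sum_e b e * linf (a e) w) + 2^-1 * \sum_e linf (a e) w ^+ 2).
  rewrite /carre_du_champ; congr (_ * _).
  by rewrite !mulr_sumr -!big_split; apply: eq_bigr => e _ /=; field.
rewrite E1 E2 /quad_var /quad -E3.
have -> : linf carre_lin w = s2 * (3 / 2 * (\sum_f (\sum_e a e f * b e) * cent w f) +
    2^-1 * \sum_f (1 - 2 * p) * cent w f * B f f).
  rewrite /linf !mulr_sumr -big_split mulr_sumr; apply: eq_bigr => f _ /=.
  rewrite /carre_lin (_ : B f f = \sum_e a e f ^+ 2); first by ring.
  by apply: eq_bigr => e _; rewrite expr2.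
have -> : \sum_f cent w f * linf (carre_quad f) w =
    s2 * \sum_f cent w f * \sum_g (if f == g then 0 else B f g) * cent w g.
  rewrite mulr_sumr; apply: eq_bigr => f _; rewrite mulrCA; congr (_ * _).
  rewrite mulr_sumr; apply: eq_bigr => g _; rewrite /carre_quad.
  by case: eqP => _; rewrite ?mul0r ?mulr0 // mulrA.
have -> : \sum_f cent w f ^+ 2 * B f f =
    \sum_f (1 - 2 * p) * cent w f * B f f + s2 * \sum_f B f f.
  rewrite mulr_sumr -big_split; apply: eq_bigr => f _ /=.
  by rewrite sqr_cent mulrDl.
by field.
Qed.

End quadratic_form.

(** * Stein's bound for quadratic forms *)

Section quadratic_stein.
Context {R : realType} {E : finType} (p : R).
Local Notation s2 := (p * (1 - p)).
Variables (b : E -> R) (a : E -> E -> R).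
Hypothesis p01 : 0 <= p <= 1.
Hypothesis a_sym : forall e f, a e f = a f e.
Hypothesis a_diag : forall e, a e e = 0.

Let s2_ge0 : 0 <= s2.
Proof. by case/andP: p01 => ? ?; rewrite mulr_ge0 // subr_ge0. Qed.

(** Convexity of the cube gives the factor 4, and AM-GM trades the third absolute moment for the
    second and fourth, which integration by parts can reach. *)
Lemma cubic_split (x y t : R) : 0 < t ->
  (`|x| + `|y|) ^+ 3 <= 4 * (`|x| ^+ 3 + 2^-1 * (t * y ^+ 2 + y ^+ 4 / t)).
Proof.
move=> t0.
have -> : y ^+ 2 = `|y| ^+ 2 by rewrite real_normK ?num_real.
have -> : y ^+ 4 = `|y| ^+ 4 by rewrite -normrX ger0_norm // exprn_even_ge0.
move: (normr_ge0 x) (normr_ge0 y); move: `|x| `|y| => u v u0 v0.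
have H1 : (u + v) ^+ 3 <= 4 * (u ^+ 3 + v ^+ 3).
  rewrite -subr_ge0.
  have -> : 4 * (u ^+ 3 + v ^+ 3) - (u + v) ^+ 3 = 3 * ((u + v) * (u - v) ^+ 2).
    by ring.
  by rewrite mulr_ge0 ?ler0n // mulr_ge0 ?sqr_ge0 // addr_ge0.
have H2 : v ^+ 3 <= 2^-1 * (t * v ^+ 2 + v ^+ 4 / t).
  rewrite -subr_ge0.
  have -> : 2^-1 * (t * v ^+ 2 + v ^+ 4 / t) - v ^+ 3 =
      v ^+ 2 * (t - v) ^+ 2 / (2 * t) by field; rewrite gt_eqF.
  by apply: divr_ge0; apply: mulr_ge0; rewrite ?sqr_ge0 ?ler0n ?(ltW t0).
by lra.
Qed.

(* [t] is the free parameter of |L|^3 <= (t L^2 + L^4 / t) / 2. *)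
Lemma quad_stein (f f' : R -> R) (C1 C2 t : R) : 0 < t ->
  (forall x, `|f' x| <= C1) ->
  (forall x y, `|f y - f x - (y - x) * f' x| <= C2 * (y - x) ^+ 2) ->
  `|bexp p (fun w => quad p b a w * f (quad p b a w))
    - quad_var p b a * bexp p (fun w => f' (quad p b a w))| <=
  C1 * Num.sqrt (quad_var p (carre_lin p b a) (carre_quad p a)) +
  4 * C2 * s2 * \sum_e (`|b e| ^+ 3 + 2^-1 * (t * (s2 * \sum_g a e g ^+ 2) +
     (9 / 2 * (s2 * \sum_g a e g ^+ 2) ^+ 2 + 3 * s2 * \sum_g a e g ^+ 4) / t)).
Proof.
move=> t0 f'C1 taylor.
set P := quad p b a; set L := fun e => linf p (a e).
have C2_ge0 : 0 <= C2.
  have := le_trans (normr_ge0 _) (taylor 0 1).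
  by rewrite subr0 expr1n mulr1.
pose G := carre_du_champ p b a.
pose rem e w := disc e (f \o P) w - (b e + L e w) * f' (P w).
have remE : bexp p (fun w => P w * f (P w)) =
    bexp p (fun w => G w * f' (P w)) +
    s2 * \sum_e bexp p (fun w => (b e + 2^-1 * L e w) * rem e w).
  rewrite (bexp_quadM p b a_diag (f \o P)).
  transitivity (s2 * \sum_e bexp p (fun w => (b e + 2^-1 * L e w) *
      (b e + L e w) * f' (P w) + (b e + 2^-1 * L e w) * rem e w)).
    congr (_ * _); apply: eq_bigr => e _; apply: eq_bexp => w.
    by rewrite /rem /L; ring.
  under eq_bigr do rewrite bexpD.
  rewrite big_split mulrDr /= -bexp_sum -bexpZ; congr (_ + _).
  by apply: eq_bexp => w; rewrite /G /carre_du_champ -[RHS]mulrA mulr_suml.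
(* [P w] is one of the two values being compared, so the Taylor estimate is used from the endpoint
   where [w] sits; if [w e] holds, it is read backwards. *)
have rem_le e w : `|rem e w| <= C2 * (b e + L e w) ^+ 2.
  have dE : P (setc w e true) - P (setc w e false) = b e + L e w.
    exact: disc_quad.
  rewrite /rem /disc /=; case wE : (w e).
    have -> : P w = P (setc w e true) by rewrite -wE setc_id.
    have := taylor (P (setc w e true)) (P (setc w e false)).
    by rewrite -dE -[X in X <= _]normrN -(sqrrN (_ - _)); congr (`|_| <= _ * _ ^+ _); ring.
  have -> : P w = P (setc w e false) by rewrite -wE setc_id.
  by have := taylor (P (setc w e false)) (P (setc w e true)); rewrite dE.
rewrite remE.
have -> : bexp p (fun w => G w * f' (P w)) =
    quad_var p b a * bexp p (fun w => f' (P w)) +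
    bexp p (fun w => quad p (carre_lin p b a) (carre_quad p a) w * f' (P w)).
  rewrite -bexpZ -bexpD; apply: eq_bexp => w.
  by rewrite /G carre_quadE mulrDl.
(* [X] carries the fluctuation of the carré du champ and is bounded through its variance; [Y]
   carries the Taylor remainders. *)
set X := bexp p (fun w => quad p (carre_lin p b a) (carre_quad p a) w * f' (P w)).
set Y := s2 * _; set Z := _ * bexp p _.
rewrite (_ : Z + X + Y - Z = X + Y); last by ring.
apply: le_trans (ler_normD _ _) _; apply: lerD.
  rewrite -(@bexp_quad2 _ _ p (carre_lin p b a) (carre_quad p a)); first last.
  - by move=> e; rewrite /carre_quad eqxx.
  - move=> e g; rewrite /carre_quad eq_sym; case: eqP => // _.
    by congr (_ * _); apply: eq_bigr => h _; rewrite mulrC.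
  have C1_ge0 : 0 <= C1 by apply: le_trans (f'C1 0).
  apply: le_trans (ler_norm_bexp p01 _) _.
  apply: le_trans (ler_wpM2l C1_ge0 (bexp_norm_le_sqrt p01 _)).
  rewrite -bexpZ; apply: le_bexp => // w.
  by rewrite normrM mulrC ler_wpM2r.
rewrite /Y normrM ger0_norm // (mulrC (4 * C2)) -[leRHS]mulrA; apply: ler_wpM2l => //.
rewrite mulr_sumr; apply: le_trans (ler_norm_sum _ _ _) _.
apply: ler_sum => e _; apply: le_trans (ler_norm_bexp p01 _) _.
apply: (@le_trans _ _ (bexp p (fun w => 4 * C2 * (`|b e| ^+ 3 + 2^-1 *
   (t * L e w ^+ 2 + t^-1 * L e w ^+ 4))))).
  apply: le_bexp => // w; rewrite normrM.
  apply: (@le_trans _ _ (C2 * (`|b e| + `|L e w|) ^+ 3)); last first.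
    rewrite (mulrC 4) -mulrA (mulrC t^-1); apply: ler_wpM2l => //.
    exact: cubic_split.
  rewrite exprS mulrCA; apply: ler_pM => //.
    apply: le_trans (ler_normD _ _) _; rewrite lerD2l normrM.
    by rewrite ger0_norm ?invr_ge0 // ler_piMl // invf_le1 ?ler1n.
  apply: le_trans (rem_le e w) _; apply: ler_wpM2l => //.
  by rewrite -real_normK ?num_real // lerXn2r ?nnegrE ?addr_ge0 // ler_normD.
rewrite bexpZ bexpD bexp_cst bexpZ bexpD !bexpZ bexp_linf2.
apply: ler_wpM2l; first by rewrite mulr_ge0.
rewrite lerD2l; apply: ler_wpM2l; first by rewrite invr_ge0.
rewrite lerD2l mulrC ler_pM2r ?invr_gt0 //.
exact: bexp_linf4.
Qed.

End quadratic_stein.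

(** * Stein's equation for the centered normal law *)

Section mean_value.
Context {R : realType}.
Variables (f df : R -> R).
Hypothesis fE : forall x : R, is_derive x 1 f (df x).

Let cont_within (I : interval R) : {within [set` I], continuous f}.
Proof.
by apply: derivable_within_continuous => x _; have [] := fE x.
Qed.

Lemma MVT_between (x y : R) :
  exists2 c, `|c - x| <= `|y - x| & f y - f x = df c * (y - x).
Proof.
have [xy|/ltW yx] := leP x y.
  have [c /[!in_itv]/= /andP[xc cy] ->] :=
    MVT_segment xy (fun x _ => fE x) (@cont_within _).
  by exists c => //; rewrite !ger0_norm ?subr_ge0 // lerB.
have [c /[!in_itv]/= /andP[yc cx] Ec] :=
  MVT_segment yx (fun x _ => fE x) (@cont_within _).
exists c; first by rewrite !ler0_norm ?subr_le0 // !opprB lerB.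
by rewrite -opprB Ec -mulrN opprB.
Qed.

Lemma is_derive_nondecreasing (a x y : R) :
  (forall z, a <= z -> 0 <= df z) -> a <= x -> x <= y -> f x <= f y.
Proof.
move=> df0 ax xy; rewrite -subr_ge0.
have [c /[!in_itv]/= /andP[xc cy] ->] :=
  MVT_segment xy (fun x _ => fE x) (@cont_within _).
by rewrite mulr_ge0 ?subr_ge0 // df0 // (le_trans ax).
Qed.

End mean_value.

Lemma taylor2 {R : realType} (f df ddf : R -> R) (C x y : R) :
  (forall x : R, is_derive x 1 f (df x)) ->
  (forall x : R, is_derive x 1 df (ddf x)) ->
  (forall x, `|ddf x| <= C) ->
  `|f y - f x - (y - x) * df x| <= C * (y - x) ^+ 2.
Proof.
move=> fE dfE ddfC.
have [c cx ->] := MVT_between fE x y.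
have [d _ Ed] := MVT_between dfE x c.
rewrite (_ : _ - _ = (df c - df x) * (y - x)); last by ring.
rewrite Ed -real_normK ?num_real // !normrM expr2 mulrA ler_wpM2r //.
by rewrite ler_pM.
Qed.

Section normal_density.
Context {R : realType} (v : R).
Hypothesis v0 : 0 < v.
Local Notation phi := (normal_pdf 0 v).

Let vn0 : v != 0. Proof. by rewrite gt_eqF. Qed.

(** The parameter [v] is the standard deviation, so the variance in Stein's equation is [v ^+ 2]. *)
Lemma normal_pdf0E : phi = (fun x => normal_peak v * expR (- (x ^+ 2 / (2 * v ^+ 2)))).
Proof.
apply/funext => x; rewrite normal_pdfE // /normal_fun subr0 mulNr.
by rewrite -(mulr_natl (v ^+ 2)).
Qed.

Lemma normal_pdf_gt0 x : 0 < phi x.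
Proof. by rewrite normal_pdf0E mulr_gt0 ?expR_gt0 ?normal_peak_gt0. Qed.

Lemma normal_pdfN x : phi (- x) = phi x.
Proof. by rewrite normal_pdf0E sqrrN. Qed.

Lemma is_derive_normal_pdf (x : R) : is_derive x 1 phi (- (x / v ^+ 2) * phi x).
Proof.
rewrite normal_pdf0E.
have h : is_derive x 1 (fun y : R => - (y ^+ 2 / (2 * v ^+ 2))) (- (x / v ^+ 2)).
  apply: is_derive_eq.
  by rewrite /GRing.scale /=; field.
apply: is_derive_eq.
rewrite /GRing.scale /=; ring.
Qed.

Lemma normal_pdf_cvg0 : phi x @[x --> +oo] --> 0.
Proof.
apply/cvgrPdist_le => e e0; near=> x.
rewrite sub0r normrN ger0_norm ?(ltW (normal_pdf_gt0 _)) // normal_pdf0E.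
set K := normal_peak v; have K0 : 0 < K by exact: normal_peak_gt0.
have x0 : 1 <= x by near: x; apply: nbhs_pinfty_ge; rewrite num_real.
have xK : K * (2 * v ^+ 2) / e <= x by near: x; apply: nbhs_pinfty_ge; rewrite num_real.
have D0 : 0 < 2 * v ^+ 2 by rewrite mulr_gt0 ?exprn_gt0.
have xe : x / (2 * v ^+ 2) <= expR (x ^+ 2 / (2 * v ^+ 2)).
  apply: le_trans (expR_ge1Dx _).
  have : x / (2 * v ^+ 2) <= x ^+ 2 / (2 * v ^+ 2).
    by rewrite ler_pM2r ?invr_gt0 // expr2 ler_peMl // (le_trans _ x0).
  by lra.
rewrite /= -/K expRN ler_pdivrMr ?expR_gt0 //.
apply: le_trans (ler_wpM2l (ltW e0) xe).
by rewrite mulrA ler_pdivlMr // mulrC -ler_pdivrMl // mulrC.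
Unshelve. all: by end_near. Qed.

End normal_density.

Section stein_ode.
Context {R : realType} (v : R).
Hypothesis v0 : 0 < v.
Local Notation phi := (normal_pdf 0 v).

Let vn0 : v != 0. Proof. by rewrite gt_eqF. Qed.

(* (w - K / x) phi is nondecreasing on [x, +oo[ and tends to 0. *)
Lemma stein_ode_ub (w k : R -> R) (K x : R) :
  (forall x : R, is_derive x 1 w ((x * w x + k x) / v ^+ 2)) ->
  (forall x, `|k x| <= K) -> w x * phi x @[x --> +oo] --> 0 ->
  0 < x -> x * w x <= K.
Proof.
move=> wE kK w_cvg x0.
pose Psi y : R := (w y - K / x) * phi y.
have PsiE (y : R) : is_derive y 1 Psi ((k y + y * (K / x)) * phi y / v ^+ 2).
  have := is_derive_normal_pdf v0 y => dphi.
  have := wE y => dw.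
  rewrite /Psi; apply: is_derive_eq.
  by rewrite /GRing.scale /=; field; rewrite vn0 gt_eqF.
have Psi_ge0 : Psi y @[y --> +oo] --> 0.
  have -> : Psi = (fun y => w y * phi y - K / x * phi y).
    by apply/funext => y; rewrite /Psi mulrBl.
  rewrite -[X in _ --> X]subr0 -[X in _ --> _ - X](mulr0 (K / x)).
  by apply: cvgB => //; apply: cvgM; [exact: cvg_cst|exact: normal_pdf_cvg0].
have K0 : 0 <= K by exact: le_trans (kK 0).
have : Psi x <= 0.
  apply: (@closed_cvg _ _ +oo _ Psi [set y | Psi x <= y]
    (@closed_ge _ (Psi x)) _ _ Psi_ge0).
  near=> y => /=; apply: (@is_derive_nondecreasing _ _ _ PsiE x) => [z xz|//|]; last first.
    by near: y; apply: nbhs_pinfty_ge; rewrite num_real.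
  apply: divr_ge0; last by rewrite exprn_ge0 ?ltW.
  apply: mulr_ge0; last by rewrite ltW ?normal_pdf_gt0.
  have := kK z; rewrite ler_norml => /andP[kz _].
  (* Beyond [x] the constant [K / x] is large enough: z K / x >= K >= - k z makes the derivative of
     [Psi] nonnegative. *)
  have : K <= z * (K / x) by rewrite mulrCA ler_peMr // ler_pdivlMr ?mul1r.
  by lra.
rewrite /Psi pmulr_lle0 ?normal_pdf_gt0 // subr_le0 ler_pdivlMr //.
by rewrite mulrC.
Unshelve. all: by end_near. Qed.

(** Two symmetries of the equation extend the one-sided bound: (w, k) to (-w, -k) gives the lower
    bound, and (w(x), k(x)) to (-w(-x), k(-x)) gives the negative half-line. It serves both for the
    Stein solution and for its derivative. *)
Lemma stein_ode_bound (w k : R -> R) (K x : R) :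
  (forall x : R, is_derive x 1 w ((x * w x + k x) / v ^+ 2)) ->
  (forall x, `|k x| <= K) ->
  w x * phi x @[x --> +oo] --> 0 -> w (- x) * phi x @[x --> +oo] --> 0 ->
  `|x * w x| <= K.
Proof.
move=> wE kK wy wNy.
have K0 : 0 <= K by exact: le_trans (kK 0).
have odeN (u l : R -> R) : (forall x : R, is_derive x 1 u ((x * u x + l x) / v ^+ 2)) ->
    forall x : R, is_derive x 1 (fun x => - u x) ((x * - u x + - l x) / v ^+ 2).
  move=> uE y; have := uE y => du; apply: is_derive_eq.
  by rewrite mulrN -opprD mulNr.
have cvgN0 (u : R -> R) : u x * phi x @[x --> +oo] --> 0 ->
    - u x * phi x @[x --> +oo] --> 0.
  move=> uy; rewrite -[X in _ --> X]oppr0.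
  by under eq_fun do rewrite mulNr; exact: cvgN.
have wrE : forall x : R, is_derive x 1 (fun x => - w (- x))
    ((x * - w (- x) + k (- x)) / v ^+ 2).
  move=> y.
  have dN : is_derive y 1 (fun y : R => - y) (-1) by exact: is_deriveN.
  have dw : is_derive (- y) 1 w ((- y * w (- y) + k (- y)) / v ^+ 2) by [].
  have := @is_derive1_comp _ _ _ _ _ _ dw dN => dc.
  by apply: is_derive_eq; rewrite /GRing.scale /=; ring.
have pos (u l : R -> R) y : (forall x : R, is_derive x 1 u ((x * u x + l x) / v ^+ 2)) ->
    (forall x, `|l x| <= K) -> u x * phi x @[x --> +oo] --> 0 -> 0 < y ->
    `|y * u y| <= K.
  move=> uE lK uy y0; rewrite ler_norml; apply/andP; split; last first.
    exact: (stein_ode_ub uE lK).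
  rewrite lerNl -mulrN.
  apply: (stein_ode_ub (odeN _ _ uE)) => //; last exact: cvgN0.
  by move=> z; rewrite normrN.
have [x0|x0|<-] := ltgtP 0 x; last by rewrite mul0r normr0.
  exact: (pos _ _ _ wE).
have := pos _ _ (- x) wrE; rewrite opprK mulrNN; apply => //.
- exact: cvgN0.
- by rewrite oppr_gt0.
Qed.

End stein_ode.

Section stein_solution.
Context {R : realType} (v : R) (g : R -> R).
Hypothesis v0 : 0 < v.
Hypothesis g_cont : continuous g.
Hypothesis g_le1 : forall x, `|g x| <= 1.
Local Notation phi := (normal_pdf 0 v).
Local Notation mu := (@lebesgue_measure R).
Local Notation nu := (@normal_prob R 0 v).

Let vn0 : v != 0. Proof. by rewrite gt_eqF. Qed.

Lemma integrable_mul_normal_pdf :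
  mu.-integrable setT (EFin \o (fun x => g x * phi x)).
Proof.
apply: (@integrableMr _ _ _ mu setT measurableT g (EFin \o phi)).
- exact: continuous_measurable_fun.
- exists 1; split => [|M M1 x _]; first exact: num_real.
  by rewrite /= (le_trans (g_le1 x)) // ltW.
- exact: integrable_normal_pdf.
Qed.

Let intS (A : set R) : measurable A ->
  mu.-integrable A (EFin \o (fun x => g x * phi x)).
Proof.
by move=> mA; apply: integrableS integrable_mul_normal_pdf => //.
Qed.

Lemma normal_probE (A : set R) : fine (nu A) = \int[mu]_(x in A) phi x.
Proof. by []. Qed.

Lemma norm_integral_mul_le (A : set R) : measurable A ->
  `|\int[mu]_(x in A) (g x * phi x)| <= fine (nu A).
Proof.
move=> mA; apply: (le_trans (@le_normr_Rintegral _ _ R mu A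
  (fun x => g x * phi x) mA (intS mA))).
rewrite normal_probE; apply: le_Rintegral => //.
- exact: integrable_norm (intS mA).
- by apply: integrableS (integrable_normal_pdf 0 v).
- move=> x _; rewrite normrM (ger0_norm (normal_pdf_ge0 _ _ _)).
  by rewrite ler_piMl ?normal_pdf_ge0.
Qed.

Hypothesis g_int0 : \int[mu]_x (g x * phi x) = 0.

Definition stein_prim (x : R) : R := \int[mu]_(t in `]-oo, x]) (g t * phi t).

Lemma is_derive_stein_prim (x : R) : is_derive x 1 stein_prim (g x * phi x).
Proof.
have [||||d dE] := @continuous_FTC1 R (fun t => g t * phi t) -oo%O x (x + 1).
- by rewrite ltrDl.
- exact: intS.
- by rewrite ltNyr.
- by apply: continuousM; [exact: g_cont|exact: continuous_normal_pdf].
by split; [exact: d|rewrite -derive1E].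
Qed.

(** The identity as a random variable under [nu]: the tails of [nu] become its cdf and complementary
    cdf, whose limits are known. *)
Let idT : measurableTypeR R -> R := idfun.

#[local] HB.instance Definition _ :=
  @isMeasurableFun.Build _ _ _ _ idT (@measurable_id _ _ setT).

Let idR : {RV nu >-> R} := idT.

Lemma stein_prim_cvgNy : stein_prim (- x) @[x --> +oo] --> 0.
Proof.
have /fine_cvgP[_ h] : nu `]-oo, (- x)] @[x --> +oo] --> 0%:E.
  by have := cvg_cdfNy0 idR; rewrite cvgNy_compNP.
apply: norm_cvg0; apply: squeeze_cvgr (cvg_cst 0) h.
near=> x; rewrite normr_ge0 /=.
by apply: norm_integral_mul_le.
Unshelve. all: by end_near. Qed.

(** Since the total integral vanishes, the primitive is minus an upper tail integral. Centering of
    [g] is what makes the Stein solution decay on this side. *)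
Lemma stein_prim_cvgy : stein_prim x @[x --> +oo] --> 0.
Proof.
have /fine_cvgP[_ h] : nu `]x, +oo[ @[x --> +oo] --> 0%:E.
  exact: cvg_ccdfy0 idR.
apply: norm_cvg0; apply: squeeze_cvgr (cvg_cst 0) h.
near=> x; rewrite normr_ge0 /=.
have := @Rintegral_itvB R (fun t => g t * phi t) -oo%O +oo%O x.
rewrite set_itvNyy g_int0 sub0r => E.
rewrite -normrN E //; first exact: norm_integral_mul_le.
exact: intS.
Unshelve. all: by end_near. Qed.

End stein_solution.

Section stein_equation.
Context {R : realType} (v : R).
Hypothesis v0 : 0 < v.
Local Notation phi := (normal_pdf 0 v).
Local Notation mu := (@lebesgue_measure R).
Local Notation nu := (@normal_prob R 0 v).

Let vn0 : v != 0. Proof. by rewrite gt_eqF. Qed.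

Let bounded_mul_cvg0 (u : R -> R) (K : R) : (forall x, `|u x| <= K) ->
  u x * phi x @[x --> +oo] --> 0.
Proof.
move=> uK; apply: norm_cvg0.
have h : K * phi x @[x --> +oo] --> 0.
  rewrite -[X in _ --> X](mulr0 K).
  by apply: cvgM; [exact: cvg_cst|exact: normal_pdf_cvg0].
apply: squeeze_cvgr (cvg_cst 0) h; near=> x.
rewrite normr_ge0 normrM /= (ger0_norm (normal_pdf_ge0 _ _ _)).
by rewrite ler_wpM2r ?normal_pdf_ge0.
Unshelve. all: by end_near. Qed.

Lemma stein_equation (g g' : R -> R) (L : R) :
  (forall x : R, is_derive x 1 g (g' x)) ->
  (forall x, `|g x| <= 1) -> (forall x, `|g' x| <= L) ->
  \int[mu]_x (g x * phi x) = 0 ->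
  exists f f' (C : R), [/\ forall x, `|f' x| <= C,
    forall x y, `|f y - f x - (y - x) * f' x| <= C * (y - x) ^+ 2 &
    forall x, v ^+ 2 * f' x - x * f x = g x].
Proof.
move=> gE g1 g'L g_int0.
have g_cont : continuous g.
  by move=> x; apply/differentiable_continuous/derivable1_diffP; have [] := gE x.
have v2n0 : v ^+ 2 != 0 by rewrite expf_neq0.
have v2_gt0 : 0 < v ^+ 2 by rewrite exprn_gt0.
(* Variation of constants: phi' = - x phi / v^2, so the equation says that (f phi)' = g phi /
   v^2. *)
pose f x := (v ^+ 2)^-1 * (stein_prim v g x / phi x).
have fE (x : R) : is_derive x 1 f ((x * f x + g x) / v ^+ 2).
  have phin0 : phi x != 0 by rewrite gt_eqF ?normal_pdf_gt0.
  have := is_derive_normal_pdf v0 x => dphi.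
  have := is_deriveV phin0 dphi => dphiV.
  have := is_derive_stein_prim v0 g_cont g1 x => dG.
  rewrite /f; apply: is_derive_eq.
  by rewrite /GRing.scale /=; field; rewrite vn0 phin0.
have fphi x : f x * phi x = (v ^+ 2)^-1 * stein_prim v g x.
  by rewrite /f -mulrA divfK // gt_eqF ?normal_pdf_gt0.
have cst_cvg0 (u : R -> R) : u x @[x --> +oo] --> 0 ->
    (v ^+ 2)^-1 * u x @[x --> +oo] --> 0.
  move=> uy; rewrite -[X in _ --> X](mulr0 (v ^+ 2)^-1).
  by apply: cvgM; [exact: cvg_cst|].
have xf1 x : `|x * f x| <= 1.
  apply: (@stein_ode_bound _ _ v0 f g 1 x fE g1).
    have -> : (fun x => f x * phi x) = (fun x => (v ^+ 2)^-1 * stein_prim v g x).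
      by apply/funext => y; exact: fphi.
    by apply: cst_cvg0; exact: stein_prim_cvgy.
  have -> : (fun x => f (- x) * phi x) =
      (fun x => (v ^+ 2)^-1 * stein_prim v g (- x)).
    by apply/funext => y; rewrite -(normal_pdfN v0) fphi.
  by apply: (@cst_cvg0 (fun x => stein_prim v g (- x))); exact: stein_prim_cvgNy.
(* Where |x| >= 1, |f| <= |x f| <= 1. Where |x| < 1, the primitive is at most 1 in absolute value
   and the density is at least [phi 1]. *)
pose B : R := 1 + (v ^+ 2)^-1 / phi 1.
have B0 : 0 <= (v ^+ 2)^-1 / phi 1.
  by rewrite divr_ge0 ?invr_ge0 ?ltW ?normal_pdf_gt0.
have fB x : `|f x| <= B.
  have [x1|x1] := leP 1 `|x|.
    apply: (@le_trans _ _ 1); last by rewrite lerDl.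
    by apply: le_trans _ (xf1 x); rewrite (normrM x) ler_peMl.
  apply: (@le_trans _ _ ((v ^+ 2)^-1 / phi 1)); last by rewrite lerDr.
  rewrite /f normrM ger0_norm ?invr_ge0 ?(ltW v2_gt0) // ler_pM2l ?invr_gt0 //.
  rewrite normrM -[leRHS]mul1r; apply: ler_pM => //.
    apply: (le_trans (@norm_integral_mul_le _ v g g_cont g1 `]-oo, x] _)) => //.
    rewrite -lee_fin fineK; first exact: probability_le1.
    exact: fin_num_measure.
  rewrite ger0_norm ?invr_ge0 ?(ltW (normal_pdf_gt0 v0 _)) //.
  rewrite lef_pV2 ?posrE ?normal_pdf_gt0 // normal_pdf0E // /=.
  rewrite ler_pM2l ?normal_peak_gt0 // ler_expR lerN2.
  rewrite ler_pM2r ?invr_gt0 ?mulr_gt0 // expr1n -real_normK ?num_real //.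
  by rewrite expr_le1 // ltW.
pose f' x := (x * f x + g x) / v ^+ 2.
have f'B x : `|f' x| <= 2 / v ^+ 2.
  rewrite /f' normrM [X in _ * X]ger0_norm ?invr_ge0 ?(ltW v2_gt0) //.
  rewrite ler_pM2r ?invr_gt0 //; apply: le_trans (ler_normD _ _) _.
  by have := xf1 x; have := g1 x; lra.
(* [f'] solves the same equation as [f], with [f + g'] in place of [g]. *)
have f'E (x : R) : is_derive x 1 f' ((x * f' x + (f x + g' x)) / v ^+ 2).
  have := fE x => df; have := gE x => dg; rewrite /f'; apply: is_derive_eq.
  by rewrite /GRing.scale /=; field.
have xf'B x : `|x * f' x| <= B + L.
  apply: (@stein_ode_bound _ _ v0 f' (fun x => f x + g' x) (B + L) x f'E); last 2 first.
  - exact: bounded_mul_cvg0 f'B.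
  - by apply: bounded_mul_cvg0 => y; exact: f'B.
  - by move=> y; apply: le_trans (ler_normD _ _) _; rewrite lerD.
have f''B x : `|(x * f' x + (f x + g' x)) / v ^+ 2| <= 2 * (B + L) / v ^+ 2.
  rewrite normrM [X in _ * X]ger0_norm ?invr_ge0 ?(ltW v2_gt0) //.
  rewrite ler_pM2r ?invr_gt0 //; apply: le_trans (ler_normD _ _) _.
  rewrite mulr_natl mulr2n lerD //.
  by apply: le_trans (ler_normD _ _) _; rewrite lerD.
have D0 : 0 <= 2 / v ^+ 2 by exact: le_trans (f'B 0).
have D1 : 0 <= 2 * (B + L) / v ^+ 2 by exact: le_trans (f''B 0).
exists f, f', (2 / v ^+ 2 + 2 * (B + L) / v ^+ 2); split.
- by move=> x; apply: le_trans (f'B x) _; rewrite lerDl.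
- move=> x y; apply: le_trans (taylor2 x y fE f'E f''B) _.
  by rewrite ler_wpM2r ?sqr_ge0 // lerDr.
- by move=> x; rewrite /f'; field.
Qed.

End stein_equation.

(** * Smoothed indicators and approximation of the cdf *)

Section logistic.
Context {R : realType} (l a : R).
Hypothesis l0 : 0 < l.

(* A smooth substitute for the indicator function of ]-oo, a]. *)
Definition logistic (x : R) : R := (1 + expR (l * (x - a)))^-1.

Let den_gt0 x : 0 < 1 + expR (l * (x - a)).
Proof. by rewrite addr_gt0 ?expR_gt0. Qed.

Lemma is_derive_logistic (x : R) : is_derive x 1 logistic
  (- (l * (expR (l * (x - a)) * logistic x ^+ 2))).
Proof.
have den_neq0 : 1 + expR (l * (x - a)) != 0 by rewrite gt_eqF.
have d1 : is_derive x 1 (fun x : R => l * (x - a)) l.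
  by apply: is_derive_eq; rewrite /GRing.scale /=; ring.
have d3 : is_derive x 1 (fun x : R => 1 + expR (l * (x - a)))
    (expR (l * (x - a)) * l).
  by apply: is_derive_eq; rewrite /GRing.scale /=; ring.
have := @is_deriveV R (fun x => 1 + expR (l * (x - a))) x _ _ den_neq0 d3 => d4.
rewrite /logistic.
by apply: is_derive_eq; rewrite /GRing.scale /= exprVn; ring.
Qed.

Lemma logistic_gt0 x : 0 < logistic x.
Proof. by rewrite invr_gt0. Qed.

Lemma logistic_le1 x : logistic x <= 1.
Proof. by rewrite invf_le1 // lerDl expR_ge0. Qed.

Lemma expR_logistic x : expR (l * (x - a)) * logistic x = 1 - logistic x.
Proof.
by rewrite /logistic; field; rewrite gt_eqF.
Qed.

(** By [expR_logistic] the derivative is - l h (1 - h), where h is the logistic function with values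
    in [0, 1]. *)
Lemma norm_derive_logistic x :
  `|- (l * (expR (l * (x - a)) * logistic x ^+ 2))| <= l.
Proof.
rewrite normrN ger0_norm; last first.
  by rewrite !mulr_ge0 ?expR_ge0 ?exprn_ge0 ?(ltW (logistic_gt0 _)) // ltW.
rewrite expr2 (mulrA (expR _)) expR_logistic ler_piMr ?(ltW l0) //.
have := logistic_gt0 x; have := logistic_le1 x; nra.
Qed.

Lemma logistic_le_tail (d x : R) : a + d <= x -> logistic x <= expR (- (l * d)).
Proof.
move=> adx; rewrite /logistic expRN lef_pV2 ?posrE ?expR_gt0 //.
apply: (@le_trans _ _ (expR (l * (x - a)))); last by rewrite lerDr.
by rewrite ler_expR ler_pM2l // lerBrDl.
Qed.

Lemma logistic_ge_tail (d x : R) : x <= a - d -> 1 - expR (- (l * d)) <= logistic x.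
Proof.
move=> xad; rewrite lerBlDr addrC -lerBlDr -expR_logistic.
apply: (@le_trans _ _ (expR (l * (x - a)))).
  by rewrite ler_piMr ?expR_ge0 // logistic_le1.
by rewrite ler_expR -mulrN ler_pM2l //; lra.
Qed.

End logistic.

Section stein_cdf.
Context {R : realType} (v : R).
Hypothesis v0 : 0 < v.
Local Notation phi := (normal_pdf 0 v).
Local Notation mu := (@lebesgue_measure R).
Local Notation nu := (@normal_prob R 0 v).
Local Notation Phi t := (fine (nu `]-oo, t])).

Let fine_nu_le1 (A : set R) : measurable A -> fine (nu A) <= 1.
Proof.
by move=> mA; rewrite -lee_fin fineK ?probability_le1 // fin_num_measure.
Qed.

Let int_phi (A : set R) : measurable A -> mu.-integrable A (EFin \o phi).
Proof. by move=> mA; apply: integrableS (integrable_normal_pdf 0 v). Qed.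

Section logistic_mean.
Variables l a : R.
Hypothesis l0 : 0 < l.
Local Notation h := (logistic l a).

Let norm_h x : `|h x| <= 1.
Proof. by rewrite ger0_norm ?logistic_le1 ?(ltW (logistic_gt0 _ _ _)). Qed.

Let h_cont : continuous h.
Proof.
move=> x; apply/differentiable_continuous/derivable1_diffP.
by have [] := is_derive_logistic l a x.
Qed.

Let int_h (A : set R) : measurable A ->
  mu.-integrable A (EFin \o (fun x => h x * phi x)).
Proof.
by move=> mA; apply: integrableS (integrable_mul_normal_pdf v h_cont norm_h).
Qed.

Definition logistic_mean : R := \int[mu]_x (h x * phi x).

Lemma logistic_mean01 : 0 <= logistic_mean <= 1.
Proof.
apply/andP; split.
  apply: Rintegral_ge0 => x _.
  by rewrite mulr_ge0 ?normal_pdf_ge0 ?(ltW (logistic_gt0 _ _ _)).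
apply: le_trans (ler_norm _) _.
apply: le_trans (norm_integral_mul_le _ h_cont norm_h measurableT) _.
exact: fine_nu_le1.
Qed.

Let mean_split z : logistic_mean = \int[mu]_(x in `]-oo, z]) (h x * phi x) +
  \int[mu]_(x in `]z, +oo[) (h x * phi x).
Proof.
rewrite -(@Rintegral_itvB R (fun t => h t * phi t) -oo%O +oo%O z) //.
  by rewrite set_itvNyy /logistic_mean; ring.
exact: int_h.
Qed.

(** Below [a + d] the logistic function is at most 1; above, it is at most its exponential tail. *)
Lemma logistic_mean_le d : logistic_mean <= Phi (a + d) + expR (- (l * d)).
Proof.
rewrite (mean_split (a + d)) lerD //.
  apply: le_trans (ler_norm _) _.
  exact: norm_integral_mul_le.
apply: (@le_trans _ _ (expR (- (l * d)) * fine (nu `]a + d, +oo[))); last first.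
  by rewrite ler_piMr ?expR_ge0 ?fine_nu_le1.
rewrite normal_probE -RintegralZl //; last exact: int_phi.
apply: le_Rintegral => //; first exact: int_h.
  apply: (@integrableZl _ _ _ mu _ _ (expR (- (l * d))) (EFin \o phi)) => //.
  exact: int_phi.
move=> x /=; rewrite in_itv /= andbT => /ltW adx.
by rewrite ler_wpM2r ?normal_pdf_ge0 // logistic_le_tail.
Qed.

Lemma logistic_mean_ge d : Phi (a - d) - expR (- (l * d)) <= logistic_mean.
Proof.
rewrite (mean_split (a - d)).
set e := expR _.
apply: (@le_trans _ _ ((1 - e) * Phi (a - d))).
  rewrite mulrBl mul1r lerD2l lerN2 ler_piMr ?expR_ge0 //.
  exact: fine_nu_le1.
rewrite -[leLHS]addr0 lerD //; last first.
  apply: Rintegral_ge0 => x _.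
  by rewrite mulr_ge0 ?normal_pdf_ge0 ?(ltW (logistic_gt0 _ _ _)).
rewrite normal_probE -RintegralZl //; last exact: int_phi.
apply: le_Rintegral => //; last first.
- move=> x /=; rewrite in_itv /= => xad.
  by rewrite ler_wpM2r ?normal_pdf_ge0 // logistic_ge_tail.
- exact: int_h.
- by apply: (@integrableZl _ _ _ mu _ _ (1 - e) (EFin \o phi)) => //; exact: int_phi.
Qed.

Lemma logistic_stein : exists f f' (C : R), [/\ forall x, `|f' x| <= C,
    forall x y, `|f y - f x - (y - x) * f' x| <= C * (y - x) ^+ 2 &
    forall x, v ^+ 2 * f' x - x * f x = h x - logistic_mean].
Proof.
have hE := is_derive_logistic l a.
have h'l := norm_derive_logistic a l0.
pose h' x := - (l * (expR (l * (x - a)) * h x ^+ 2)).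
have gE (x : R) : is_derive x 1 (fun x => h x - logistic_mean) (h' x).
  have := hE x => dh.
  by apply: is_derive_eq; rewrite subr0.
apply: (stein_equation v0 gE _ h'l).
  move=> x; have := logistic_gt0 l a x; have := logistic_le1 l a x.
  have /andP[m0 m1] := logistic_mean01.
  by rewrite ler_norml => h1 h0; apply/andP; split; lra.
transitivity (\int[mu]_x (h x * phi x - logistic_mean * phi x)).
  by apply: eq_Rintegral => x _; rewrite mulrBl.
have iphi := int_phi measurableT.
rewrite RintegralB //; last 2 first.
- exact: int_h.
- by apply: (@integrableZl _ _ _ mu _ _ logistic_mean (EFin \o phi)).
rewrite RintegralZl // -/logistic_mean.
have -> : \int[mu]_x phi x = 1 by rewrite /Rintegral integral_normal_pdf.
by rewrite mulr1 subrr.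
Qed.

End logistic_mean.

(** The order of quantifiers is the point: [C] and [eta] depend on [y] and [eps] alone, so they
    serve all the graph spaces at once. The threshold [y'] may move, because squaring the distance
    shifts it by o(1). *)
Lemma stein_cdf_approx (y eps : R) : 0 < eps ->
  {for y, continuous (fun t : R => nu `]-oo, t]%classic)} ->
  exists C eta : R, 0 < eta /\ forall (T : finType) (m Q : T -> R) (y' : R),
    (forall t, 0 <= m t) -> \sum_t m t = 1 -> `|y' - y| <= eta ->
    (forall f f' : R -> R, (forall x, `|f' x| <= C) ->
      (forall x y, `|f y - f x - (y - x) * f' x| <= C * (y - x) ^+ 2) ->
      `|\sum_t m t * (Q t * f (Q t) - v ^+ 2 * f' (Q t))| <= eta) ->
    `|\sum_(t | Q t <= y') m t - Phi y| <= eps.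
Proof.
move=> eps0 cont.
have [r r0 Hr] : exists2 r : R, 0 < r &
    forall t, `|t - y| < r -> `|Phi t - Phi y| <= eps / 4.
  have : nu `]-oo, t] @[t --> y] --> (Phi y)%:E.
    by rewrite fineK ?fin_num_measure //; exact: cont.
  move=> /fine_cvgP[_] /cvgrPdist_le /(_ (eps / 4)).
  case; first by rewrite divr_gt0.
  move=> r /= r0 Hr; exists r => // t ty; rewrite distrC.
  by apply: Hr; rewrite /= distrC.
(* With [l * d = 8 / eps] the tail e^(-ld) is at most 1/(ld) = eps/8. The total error is eps/4 from
   Stein's equation, eps/4 from continuity and two tails of eps/8, which is below [eps]. *)
pose d := r / 4; have d0 : 0 < d by rewrite divr_gt0.
pose l := 8 / eps / d; have l0 : 0 < l by rewrite !divr_gt0.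
have e_le : expR (- (l * d)) <= eps / 8.
  rewrite expRN /l divfK ?gt_eqF // -[leRHS]invrK invf_div.
  rewrite lef_pV2 ?posrE ?expR_gt0 ?divr_gt0 //.
  by apply: le_trans (expR_ge1Dx _); rewrite lerDr.
(* The offset 2d leaves d for the displacement of [y'] and d for the transition of the logistic
   function. One more d when passing to [Phi] gives y + 3d and y - 3d, both within [r] of [y]. *)
have [f1 [f1' [C1 [f1'C t1 E1]]]] := logistic_stein (y + 2 * d) l0.
have [f2 [f2' [C2 [f2'C t2 E2]]]] := logistic_stein (y - 2 * d) l0.
have C10 : 0 <= C1 by exact: le_trans (f1'C 0).
have C20 : 0 <= C2 by exact: le_trans (f2'C 0).
exists (C1 + C2), (Num.min d (eps / 4)); split.
  by rewrite lt_min d0 divr_gt0.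
move=> T m Q y' m0 m1; rewrite le_min => /andP[yd _] H.
have phiU : `|Phi (y + 3 * d) - Phi y| <= eps / 4.
  apply: Hr; rewrite addrC addKr gtr0_norm ?mulr_gt0 //.
  by rewrite /d; lra.
have phiL : `|Phi (y - 3 * d) - Phi y| <= eps / 4.
  apply: Hr; rewrite addrC addKr normrN gtr0_norm ?mulr_gt0 //.
  by rewrite /d; lra.
have mean h c f f' : (forall x, v ^+ 2 * f' x - x * f x = h x - c) ->
    `|\sum_t m t * (Q t * f (Q t) - v ^+ 2 * f' (Q t))| <= Num.min d (eps / 4) ->
    `|\sum_t m t * h (Q t) - c| <= eps / 4.
  move=> E; rewrite le_min => /andP[_]; apply: le_trans.
  rewrite -normrN -[c in X in X <= _](mul1r c) -m1 mulr_suml opprB -sumrB.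
  by rewrite le_eqVlt; apply/orP; left; apply/eqP; congr (`|_|);
    apply: eq_bigr => t _; rewrite -mulrBr -opprB -E opprB.
have M1 : `|\sum_t m t * logistic l (y + 2 * d) (Q t) -
    logistic_mean l (y + 2 * d)| <= eps / 4.
  apply: (mean _ _ _ _ E1); apply: H => [x|x z].
    by apply: le_trans (f1'C x) _; rewrite lerDl.
  by apply: le_trans (t1 x z) _; rewrite ler_wpM2r ?sqr_ge0 // lerDl.
have M2 : `|\sum_t m t * logistic l (y - 2 * d) (Q t) -
    logistic_mean l (y - 2 * d)| <= eps / 4.
  apply: (mean _ _ _ _ E2); apply: H => [x|x z].
    by apply: le_trans (f2'C x) _; rewrite lerDr.
  by apply: le_trans (t2 x z) _; rewrite ler_wpM2r ?sqr_ge0 // lerDr.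
set e := expR (- (l * d)) in e_le.
move: yd; rewrite ler_norml => /andP[yd1 yd2].
have sum_e : \sum_t m t * e = e by rewrite -mulr_suml m1 mul1r.
have U : \sum_(t | Q t <= y') m t <= \sum_t m t * logistic l (y + 2 * d) (Q t) + e.
  rewrite -[X in _ + X]sum_e -big_split big_mkcond; apply: ler_sum => t _ /=.
  case: ifP => [Qy|_].
    rewrite -mulrDr ler_peMr // -lerBlDr; apply: logistic_ge_tail => //.
    by lra.
  by rewrite addr_ge0 ?mulr_ge0 ?expR_ge0 ?(ltW (logistic_gt0 _ _ _)).
have L : \sum_t m t * logistic l (y - 2 * d) (Q t) - e <= \sum_(t | Q t <= y') m t.
  rewrite -[X in _ - X]sum_e -sumrB [leRHS]big_mkcond; apply: ler_sum => t _ /=.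
  rewrite -mulrBr; case: ifPn => [Qy|].
    rewrite ler_piMr //; have := logistic_le1 l (y - 2 * d) (Q t).
    by have := expR_ge0 (- (l * d)); rewrite -/e; lra.
  rewrite -ltNge => Qy; apply: mulr_ge0_le0 => //.
  rewrite subr_le0; apply: logistic_le_tail => //; lra.
have MU := logistic_mean_le (y + 2 * d) l0 d.
have ML := logistic_mean_ge (y - 2 * d) l0 d.
rewrite -/e in MU ML.
have EU : y + 2 * d + d = y + 3 * d by ring.
have EL : y - 2 * d - d = y - 3 * d by ring.
rewrite EU in MU; rewrite EL in ML.
move: M1 M2 phiU phiL; rewrite !ler_norml.
move=> /andP[_ m1u] /andP[m2l _] /andP[_ pu] /andP[pl _].
by apply/andP; split; lra.
Qed.

End stein_cdf.

(** * Edges of the complete graph *)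

Definition edge_pred n : {pred 'I_n * 'I_n} := [pred e : 'I_n * 'I_n | (e.1 < e.2)%N].

(** One ordered pair per potential edge, matching the index set of the product in [gnp_pmf]. *)
Definition edge n := {e | e \in @edge_pred n}.

Section edges.
Context {R : realType} {n : nat}.
Implicit Types (e f : edge n) (k l : 'I_n) (G : sgraph n).

Definition inc e k : R := (k == (val e).1)%:R + (k == (val e).2)%:R.

(** The Gram matrix of the edges' incidence vectors: 2 on the diagonal and the adjacency matrix of
    the line graph elsewhere. *)
Definition overlap e f : R := \sum_k inc e k * inc f k.

Lemma sum_edge (F : 'I_n -> 'I_n -> R) :
  \sum_(e : edge n) F (val e).1 (val e).2 = \sum_(i < n) \sum_(j < n | (i < j)%N) F i j.
Proof.
rewrite pair_big_dep /=.
by rewrite -(big_sub (@edge_pred n) (fun u => F u.1 u.2)).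
Qed.

(** Exactly one edge joins [k] to each other vertex; [F k k = 0] accounts for the absent loop. *)
Lemma sum_inc_edge (F : 'I_n -> 'I_n -> R) k :
  (forall i j, F i j = F j i) -> F k k = 0 ->
  \sum_(e : edge n) inc e k * F (val e).1 (val e).2 = \sum_j F k j.
Proof.
move=> Fsym Fkk.
rewrite (sum_edge (fun i j => ((k == i)%:R + (k == j)%:R) * F i j)).
transitivity (\sum_(i < n) \sum_(j < n | (i < j)%N) (k == i)%:R * F i j +
   \sum_(i < n) \sum_(j < n | (i < j)%N) (k == j)%:R * F i j).
  rewrite -big_split; apply: eq_bigr => i _; rewrite -big_split.
  by apply: eq_bigr => j _; rewrite mulrDl.
have -> : \sum_(i < n) \sum_(j < n | (i < j)%N) (k == i)%:R * F i j =
    \sum_(j < n | (k < j)%N) F k j.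
  rewrite (bigD1 k) //= eqxx [X in _ + X]big1 ?addr0 => [|i ik].
    by apply: eq_bigr => j _; rewrite mul1r.
  by rewrite big1 // => j _; rewrite eq_sym (negbTE ik) mul0r.
have -> : \sum_(i < n) \sum_(j < n | (i < j)%N) (k == j)%:R * F i j =
    \sum_(j < n | (j < k)%N) F k j.
  rewrite [RHS]big_mkcond; apply: eq_bigr => i _; rewrite big_mkcond (bigD1 k) //=.
  rewrite eqxx mul1r Fsym big1 ?addr0 // => j jk.
  by rewrite [k == j]eq_sym (negbTE jk) mul0r if_same.
rewrite [RHS](bigID (fun j : 'I_n => (k < j)%N)) /=; congr (_ + _).
rewrite [RHS](bigD1 k) ?ltnn //= Fkk add0r.
by apply: eq_bigl => j; rewrite -leqNgt ltn_neqAle andbC.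
Qed.

Lemma edge_neq e : (val e).1 != (val e).2.
Proof. by rewrite neq_ltn; apply/orP; left; exact: (valP e). Qed.

Lemma inc01 e k : inc e k = 0 \/ inc e k = 1.
Proof.
rewrite /inc; have := edge_neq e.
case: (eqVneq k (val e).1) => [->|_] /=; first by move/negbTE ->; right; rewrite addr0.
by case: (k == (val e).2) => _; [right|left]; rewrite add0r.
Qed.

Lemma inc_ge0 e k : 0 <= inc e k.
Proof. by case: (inc01 e k) => ->. Qed.

Lemma incX e k : inc e k * inc e k = inc e k.
Proof. by case: (inc01 e k) => ->; rewrite ?mul0r ?mul1r. Qed.

Lemma sum_incV e : \sum_k inc e k = 2.
Proof.
rewrite big_split /= (bigD1 (val e).1) //= eqxx big1 => [|i /negbTE ->//].
rewrite (bigD1 (val e).2) //= eqxx big1 => [|i /negbTE ->//].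
by rewrite !addr0.
Qed.

Lemma overlap_sym e f : overlap e f = overlap f e.
Proof. by apply: eq_bigr => k _; rewrite mulrC. Qed.

Lemma overlap_ge0 e f : 0 <= overlap e f.
Proof. by apply: sumr_ge0 => k _; rewrite mulr_ge0 ?inc_ge0. Qed.

Lemma overlap_le2 e f : overlap e f <= 2.
Proof.
rewrite -(sum_incV e); apply: ler_sum => k _.
by case: (inc01 f k) => ->; rewrite ?mulr0 ?mulr1 ?inc_ge0.
Qed.

Lemma meetee e : overlap e e = 2.
Proof. by rewrite -(sum_incV e); apply: eq_bigr => k _; rewrite incX. Qed.

Lemma sum_incE k : \sum_(e : edge n) inc e k = n%:R - 1.
Proof.
transitivity (\sum_j ((k != j)%:R : R)).
  rewrite -(@sum_inc_edge (fun i j => (i != j)%:R)) ?eqxx //.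
    by apply: eq_bigr => e _; rewrite edge_neq mulr1.
  by move=> i j; rewrite eq_sym.
transitivity (\sum_j (1 - (k == j)%:R : R)).
  by apply: eq_bigr => j _; case: eqP; rewrite ?subrr ?subr0.
rewrite sumrB sumr_const card_ord; congr (_ - _).
rewrite (bigD1 k) //= eqxx big1 ?addr0 // => i.
by rewrite eq_sym => /negbTE ->.
Qed.

(** Two distinct vertices share one edge, and 1 + (n - 2) edges contain a given vertex: in matrix
    form B B^T = J + (n-2) I, with B the incidence matrix and J the all-ones matrix. *)
Lemma sum_inc2 k l :
  \sum_(e : edge n) inc e k * inc e l = 1 + (k == l)%:R * (n%:R - 2).
Proof.
case: (eqVneq k l) => [<-|kl] /=.
  under eq_bigr do rewrite incX.
  by rewrite sum_incE; ring.
pose X (i j : 'I_n) : R := (i != j)%:R * ((l == i)%:R + (l == j)%:R).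
transitivity (\sum_(e : edge n) inc e k * X (val e).1 (val e).2).
  by apply: eq_bigr => e _; rewrite /X edge_neq mul1r.
rewrite sum_inc_edge /X.
- rewrite (bigD1 l) //= kl eqxx [l == k]eq_sym (negbTE kl) big1 => [|i il].
    by rewrite /=; ring.
  by rewrite [l == i]eq_sym (negbTE il) addr0 mulr0.
- by move=> i j; rewrite eq_sym addrC.
- by rewrite eqxx mul0r.
Qed.

Lemma sum_edge1 : \sum_(e : edge n) (1 : R) = n%:R * (n%:R - 1) / 2.
Proof.
have : \sum_(e : edge n) \sum_k inc e k = n%:R * (n%:R - 1).
  rewrite exchange_big /=; under eq_bigr do rewrite sum_incE.
  by rewrite sumr_const card_ord mulr_natl.
under eq_bigr do rewrite sum_incV.
rewrite [X in X = _](_ : _ = 2 * \sum_(e : edge n) 1).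
  by move=> <-; field.
by rewrite mulr_sumr; apply: eq_bigr => e _; rewrite mulr1.
Qed.

Lemma sum_overlap f : \sum_e overlap e f = 2 * (n%:R - 1).
Proof.
rewrite exchange_big /= -(sum_incV f) mulr_suml; apply: eq_bigr => k _.
by rewrite -mulr_suml sum_incE mulrC.
Qed.

(** B B^T = J + (n-2) I is sandwiched between the incidence vectors of [f] and [g], whose entries
    each sum to 2; J contributes 4. The number of common neighbours in the line graph enters the
    variance of the carré du champ in this way. *)
Lemma sum_overlap2 f g :
  \sum_e overlap e f * overlap e g = 4 + (n%:R - 2) * overlap f g.
Proof.
transitivity (\sum_k \sum_l inc f k * inc g l * \sum_e inc e k * inc e l).
  under [RHS]eq_bigr do under eq_bigr do rewrite mulr_sumr.
  under [RHS]eq_bigr do rewrite exchange_big.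
  rewrite [RHS]exchange_big; apply: eq_bigr => e _ /=.
  rewrite mulr_suml; apply: eq_bigr => k _; rewrite mulr_sumr.
  by apply: eq_bigr => l _; ring.
under eq_bigr do under eq_bigr do rewrite sum_inc2 mulrDr mulr1.
under eq_bigr do rewrite big_split.
rewrite big_split /=; congr (_ + _).
  under eq_bigr do rewrite -mulr_sumr sum_incV.
  by rewrite -mulr_suml sum_incV -natrM.
rewrite /overlap mulr_sumr; apply: eq_bigr => k _.
rewrite (bigD1 k) //= eqxx big1 ?addr0 => [|l]; first by rewrite /=; ring.
by rewrite eq_sym => /negbTE ->; rewrite mul0r mulr0.
Qed.

Lemma sum_sum_overlap2 :
  \sum_(e : edge n) \sum_(f : edge n) overlap e f ^+ 2 = n%:R ^+ 2 * (n%:R - 1).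
Proof.
transitivity (\sum_(f : edge n) \sum_(e : edge n) overlap e f * overlap e f).
  by rewrite exchange_big.
transitivity ((4 + (n%:R - 2) * 2) * \sum_(e : edge n) (1 : R)).
  by rewrite mulr_sumr; apply: eq_bigr => f _; rewrite sum_overlap2 meetee mulr1.
by rewrite sum_edge1; field.
Qed.

Lemma sum_overlap_sq f : \sum_e overlap e f ^+ 2 <= 4 * n%:R.
Proof.
apply: (@le_trans _ _ (2 * \sum_e overlap e f)).
  rewrite mulr_sumr; apply: ler_sum => e _.
  by rewrite expr2 ler_wpM2r ?overlap_ge0 ?overlap_le2.
by rewrite sum_overlap; lra.
Qed.

End edges.

(** * Quadratic forms on the line graph of the complete graph *)

Section line_graph_form.
Context {R : realType} {n : nat} (p k : R) (b : edge n -> R).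
Implicit Types (e f g : edge n).
Local Notation s2 := (p * (1 - p)).
Local Notation N := (n%:R : R).
Hypothesis p01 : 0 < p < 1.
Hypothesis k0 : 0 < k.
Hypothesis n_gt0 : (0 < n)%N.
Hypothesis b_le : forall e, `|b e| <= 8 * k.

(** The 2 cancels the 1/2 in [quad]. The diagonal is dropped since x_e^2 is affine in x_e and goes
    into the linear part and the mean. *)
Definition line_coef (c : R) (e f : edge n) : R := if e == f then 0 else 2 * c * overlap e f.

Lemma line_coef_sym c e f : line_coef c e f = line_coef c f e.
Proof. by rewrite /line_coef eq_sym overlap_sym. Qed.

Lemma line_coef_diag c e : line_coef c e e = 0.
Proof. by rewrite /line_coef eqxx. Qed.

Lemma sum_line_coef2 c :
  \sum_e \sum_f line_coef c e f ^+ 2 = 4 * c ^+ 2 * (N * (N - 1) * (N - 2)).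
Proof.
transitivity (4 * c ^+ 2 *
   (\sum_(e : edge n) \sum_(f : edge n) overlap e f ^+ 2 - 4 * \sum_(e : edge n) 1)).
  rewrite mulrBr (mulrA (4 * c ^+ 2)) !mulr_sumr -sumrB; apply: eq_bigr => e _.
  rewrite (bigD1 e) //= line_coef_diag expr0n add0r.
  rewrite [in RHS](bigD1 e) //= meetee mulrDr mulr_sumr.
  rewrite (eq_bigr (fun f => 4 * c ^+ 2 * overlap e f ^+ 2)); first by ring.
  move=> f; rewrite /line_coef eq_sym => /negbTE ->; ring.
by rewrite sum_sum_overlap2 sum_edge1; field.
Qed.

Let s2_gt0 : 0 < s2.
Proof. by case/andP: p01 => p0 p1; rewrite mulr_gt0 // subr_gt0. Qed.

Let N1 : 1 <= N. Proof. by rewrite ler1n. Qed.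

Let line_coef_ge0 e f : 0 <= line_coef k e f.
Proof.
rewrite /line_coef; case: ifP => // _.
by rewrite mulr_ge0 ?overlap_ge0 // mulr_ge0 ?ltW.
Qed.

Let line_coef_le e f : line_coef k e f <= 2 * k * overlap e f.
Proof.
rewrite /line_coef; case: ifP => // _.
by rewrite mulr_ge0 ?overlap_ge0 // mulr_ge0 // ltW.
Qed.

Let sum_edge1_le : \sum_(e : edge n) (1 : R) <= N ^+ 2 / 2.
Proof. by rewrite sum_edge1 ler_pM2r ?invr_gt0 // expr2 ler_wpM2l ?ler0n // gerBl. Qed.

Let sum_edge_le (F : edge n -> R) (K : R) : 0 <= K -> (forall e, F e <= K) ->
  \sum_e F e <= N ^+ 2 / 2 * K.
Proof.
move=> K0 FK; apply: (@le_trans _ _ ((\sum_(e : edge n) 1) * K)).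
  by rewrite mulr_suml; apply: ler_sum => e _; rewrite mul1r.
by rewrite ler_wpM2r.
Qed.

Let row2 e : \sum_f line_coef k e f ^+ 2 <= 16 * k ^+ 2 * N.
Proof.
apply: (@le_trans _ _ (\sum_f 4 * k ^+ 2 * overlap f e ^+ 2)).
  apply: ler_sum => f _; rewrite overlap_sym.
  have -> : 4 * k ^+ 2 * overlap e f ^+ 2 = (2 * k * overlap e f) ^+ 2 by ring.
  by rewrite lerXn2r ?nnegrE ?(le_trans (line_coef_ge0 e f) (line_coef_le e f)).
rewrite -mulr_sumr; apply: (@le_trans _ _ (4 * k ^+ 2 * (4 * N))); last by lra.
by rewrite ler_wpM2l ?sum_overlap_sq // mulr_ge0 ?exprn_ge0 // ltW.
Qed.

(** Every coefficient is at most [4 * k], so two of the four factors come out and [row2] handles the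
    rest. *)
Let row4 e : \sum_f line_coef k e f ^+ 4 <= 256 * k ^+ 4 * N.
Proof.
apply: (@le_trans _ _ (\sum_f 16 * k ^+ 2 * line_coef k e f ^+ 2)).
  apply: ler_sum => f _; rewrite (exprD _ 2 2) ler_wpM2r ?sqr_ge0 //.
  have -> : 16 * k ^+ 2 = (4 * k) ^+ 2 by ring.
  rewrite lerXn2r ?nnegrE ?mulr_ge0 ?(ltW k0) //.
  apply: le_trans (line_coef_le _ _) _.
  rewrite (_ : 4 * k = 2 * k * 2); last by ring.
  by rewrite ler_wpM2l ?overlap_le2 // mulr_ge0 ?(ltW k0).
rewrite -mulr_sumr (_ : 256 * k ^+ 4 * N = 16 * k ^+ 2 * (16 * k ^+ 2 * N)); last by ring.
by rewrite ler_wpM2l ?row2 // mulr_ge0 ?exprn_ge0 // ltW.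
Qed.

Let norm_carre_lin f : `|carre_lin p b (line_coef k) f| <= 56 * s2 * k ^+ 2 * N.
Proof.
rewrite /carre_lin normrM ger0_norm ?(ltW s2_gt0) //.
rewrite (_ : 56 * s2 * k ^+ 2 * N = s2 * (48 * k ^+ 2 * N + 8 * k ^+ 2 * N)); last by ring.
rewrite ler_wpM2l ?(ltW s2_gt0) //; apply: le_trans (ler_normD _ _) _.
apply: lerD.
  rewrite normrM ger0_norm ?divr_ge0 //.
  rewrite (_ : 48 * k ^+ 2 * N = 3 / 2 * (32 * k ^+ 2 * N)); last by field.
  rewrite ler_wpM2l ?divr_ge0 //; apply: le_trans (ler_norm_sum _ _ _) _.
  apply: (@le_trans _ _ (\sum_e 16 * k ^+ 2 * overlap e f)).
    apply: ler_sum => e _; rewrite normrM ger0_norm //.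
    have -> : 16 * k ^+ 2 * overlap e f = 2 * k * overlap e f * (8 * k) by ring.
    by apply: ler_pM.
  rewrite -mulr_sumr sum_overlap.
  have : 0 <= k ^+ 2 by rewrite exprn_ge0 ?ltW.
  by nra.
rewrite !normrM ger0_norm ?invr_ge0 //.
rewrite [X in _ * X]ger0_norm; last by apply: sumr_ge0 => e _; rewrite sqr_ge0.
rewrite (_ : 8 * k ^+ 2 * N = 2^-1 * 1 * (16 * k ^+ 2 * N)); last by field.
apply: ler_pM => //.
- by apply: sumr_ge0 => e _; rewrite sqr_ge0.
- rewrite ler_wpM2l ?invr_ge0 // ler_norml.
  by case/andP: p01 => p0 p1; apply/andP; split; lra.
- by under eq_bigr do rewrite line_coef_sym; exact: row2.
Qed.

(** [sum_overlap2] separates a constant from a part of size N on overlapping edges; (u + v)^2 <= 2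
    u^2 + 2 v^2 keeps them apart. *)
Let carre_quad_sq f g : carre_quad p (line_coef k) f g ^+ 2 <=
  32 * k ^+ 4 * s2 ^+ 2 * (16 + N ^+ 2 * overlap f g ^+ 2).
Proof.
have M0 := @overlap_ge0 R _ f g.
apply: (@le_trans _ _ ((4 * k ^+ 2 * s2 * (4 + N * overlap f g)) ^+ 2)); last first.
  rewrite [leRHS](_ : _ =
    (4 * k ^+ 2 * s2) ^+ 2 * (2 * (16 + (N * overlap f g) ^+ 2))); last by ring.
  rewrite exprMn ler_wpM2l ?sqr_ge0 //.
  have : 0 <= (4 - N * overlap f g) ^+ 2 by rewrite sqr_ge0.
  by lra.
have S0 : 0 <= \sum_e line_coef k e f * line_coef k e g.
  by apply: sumr_ge0 => e _; rewrite mulr_ge0.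
have le1 : \sum_e line_coef k e f * line_coef k e g <= 4 * k ^+ 2 * (4 + N * overlap f g).
  apply: (@le_trans _ _ (\sum_e 4 * k ^+ 2 * (overlap e f * overlap e g))).
    apply: ler_sum => e _.
    rewrite (_ : 4 * k ^+ 2 * _ = (2 * k * overlap e f) * (2 * k * overlap e g)); last by ring.
    by apply: ler_pM.
  rewrite -mulr_sumr sum_overlap2 ler_wpM2l ?mulr_ge0 ?exprn_ge0 ?(ltW k0) //.
  by lra.
have le2 : s2 * \sum_e line_coef k e f * line_coef k e g <=
    4 * k ^+ 2 * s2 * (4 + N * overlap f g).
  rewrite [leRHS](_ : _ = s2 * (4 * k ^+ 2 * (4 + N * overlap f g))); last by ring.
  by rewrite ler_wpM2l ?(ltW s2_gt0).
have S1 : 0 <= s2 * \sum_e line_coef k e f * line_coef k e g.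
  by rewrite mulr_ge0 ?(ltW s2_gt0).
rewrite /carre_quad; case: eqP => _; last first.
  by rewrite lerXn2r ?nnegrE // (le_trans S1).
by rewrite expr0n sqr_ge0.
Qed.

(** With rho as in [line_stein] the bound is 1648 rho^4 / N. The linear part gives 1568 = 56^2 / 2
    and the quadratic part 80 = 32 * 5 / 2. *)
Let carre_var : quad_var p (carre_lin p b (line_coef k)) (carre_quad p (line_coef k)) <=
  1648 * k ^+ 4 * N ^+ 3 * s2 ^+ 2 * (1 + N * s2) ^+ 2.
Proof.
have k2 : 0 <= k ^+ 2 by rewrite exprn_ge0 ?ltW.
have k4 : 0 <= k ^+ 4 by rewrite exprn_ge0 ?ltW.
have A1 : \sum_f carre_lin p b (line_coef k) f ^+ 2 <=
    N ^+ 2 / 2 * (56 * s2 * k ^+ 2 * N) ^+ 2.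
  apply: sum_edge_le => [|f]; first by rewrite sqr_ge0.
  rewrite -real_normK ?num_real // lerXn2r ?nnegrE //.
  by apply: le_trans (norm_carre_lin f).
have A2 : \sum_f \sum_g carre_quad p (line_coef k) f g ^+ 2 <=
    32 * k ^+ 4 * s2 ^+ 2 * (5 * N ^+ 5).
  apply: (@le_trans _ _ (32 * k ^+ 4 * s2 ^+ 2 *
     (\sum_(f : edge n) \sum_(g : edge n) 16 +
     N ^+ 2 * \sum_(f : edge n) \sum_(g : edge n) overlap f g ^+ 2))).
    rewrite mulr_sumr -big_split mulr_sumr; apply: ler_sum => f _ /=.
    rewrite mulr_sumr -big_split mulr_sumr; apply: ler_sum => g _ /=.
    exact: carre_quad_sq.
  have K0 : 0 <= 32 * k ^+ 4 * s2 ^+ 2 by rewrite mulr_ge0 ?sqr_ge0 // mulr_ge0.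
  apply: ler_wpM2l => //; rewrite sum_sum_overlap2.
  have -> : \sum_(f : edge n) \sum_(g : edge n) 16 =
     16 * (\sum_(f : edge n) (1 : R)) ^+ 2.
    rewrite expr2 mulrA mulr_sumr; apply: eq_bigr => f _.
    by rewrite mulr1 mulr_sumr; apply: eq_bigr => g _; rewrite mulr1.
  have B1 : (\sum_(f : edge n) (1 : R)) ^+ 2 <= (N ^+ 2 / 2) ^+ 2.
    by rewrite lerXn2r ?nnegrE ?divr_ge0 ?sqr_ge0 // sumr_ge0.
  have N4 : 0 <= N ^+ 4 by rewrite exprn_ge0.
  have N5 : N ^+ 4 <= N ^+ 5 by rewrite (exprS _ 4) ler_peMl.
  apply: (@le_trans _ _ (16 * (N ^+ 2 / 2) ^+ 2 + N ^+ 2 * (N ^+ 2 * (N - 1)))).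
    by rewrite lerD2r ler_wpM2l.
  have -> : 16 * (N ^+ 2 / 2) ^+ 2 + N ^+ 2 * (N ^+ 2 * (N - 1)) = 3 * N ^+ 4 + N ^+ 5.
    by field.
  by lra.
rewrite /quad_var.
apply: (@le_trans _ _ (s2 * (N ^+ 2 / 2 * (56 * s2 * k ^+ 2 * N) ^+ 2) +
   2^-1 * s2 ^+ 2 * (32 * k ^+ 4 * s2 ^+ 2 * (5 * N ^+ 5)))).
  apply: lerD; first by rewrite ler_wpM2l ?(ltW s2_gt0).
  by rewrite ler_wpM2l // mulr_ge0 ?invr_ge0 ?sqr_ge0.
set m := N * s2; have m0 : 0 <= m by rewrite mulr_ge0 ?(ltW s2_gt0).
pose W := k ^+ 4 * N ^+ 3 * s2 ^+ 2.
have W0 : 0 <= W by rewrite /W mulr_ge0 ?sqr_ge0 // mulr_ge0 // exprn_ge0.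
have -> : s2 * (N ^+ 2 / 2 * (56 * s2 * k ^+ 2 * N) ^+ 2) +
    2^-1 * s2 ^+ 2 * (32 * k ^+ 4 * s2 ^+ 2 * (5 * N ^+ 5)) =
    W * (1568 * m + 80 * m ^+ 2) by rewrite /W /m; field.
have -> : 1648 * k ^+ 4 * N ^+ 3 * s2 ^+ 2 * (1 + m) ^+ 2 = W * (1648 * (1 + m) ^+ 2).
  by rewrite /W; ring.
by rewrite ler_wpM2l //; nra.
Qed.

Lemma line_stein (f f' : R -> R) (C rho : R) :
  (forall x, `|f' x| <= C) ->
  (forall x y, `|f y - f x - (y - x) * f' x| <= C * (y - x) ^+ 2) ->
  rho = k * (N * Num.sqrt s2 * Num.sqrt (1 + N * s2)) ->
  `|bexp p (fun w => quad p b (line_coef k) w * f (quad p b (line_coef k) w))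
    - quad_var p b (line_coef k) * bexp p (fun w => f' (quad p b (line_coef k) w))| <=
  C * (41 * rho ^+ 2 / Num.sqrt N + 2192 * rho ^+ 3 / (N * Num.sqrt s2)).
Proof.
move=> f'C taylor ->.
set m := N * s2; have m0 : 0 <= m by rewrite mulr_ge0 ?(ltW s2_gt0).
set r := Num.sqrt (1 + m).
have r2 : r ^+ 2 = 1 + m by rewrite sqr_sqrtr // addr_ge0.
have r_gt0 : 0 < r by rewrite sqrtr_gt0 ltr_wpDr.
have r1 : 1 <= r by rewrite -[1]sqrtr1 ler_wsqrtr // lerDl.
set s := Num.sqrt s2.
have s_gt0 : 0 < s by rewrite sqrtr_gt0.
have sE : s ^+ 2 = s2 by rewrite sqr_sqrtr ?ltW.
have N0 : 0 < N by apply: lt_le_trans N1.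
have sqN : Num.sqrt N ^+ 2 = N by rewrite sqr_sqrtr ?ltW.
have sqN0 : 0 < Num.sqrt N by rewrite sqrtr_gt0.
have C0 : 0 <= C by exact: le_trans (f'C 0).
have p01' : 0 <= p <= 1 by case/andP: p01 => ? ?; rewrite !ltW.
(* [k * r] is the order of magnitude of D_e P: k from [b] and k sqrt(m) from the linear form. As the
   free parameter it balances t L^2 against L^4 / t. *)
have kr0 : 0 < k * r by rewrite mulr_gt0.
have := quad_stein b p01' (line_coef_sym k) (line_coef_diag k) kr0 f'C taylor.
move=> H; apply: le_trans H _; rewrite [leRHS]mulrDr; apply: lerD.
  rewrite ler_wpM2l // -(@ger0_norm _ (41 * _ / _)); last first.
    by rewrite divr_ge0 ?mulr_ge0 ?sqr_ge0 // ltW.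
  rewrite -sqrtr_sqr ler_wsqrtr //; apply: le_trans carre_var _.
  rewrite -/m -r2.
  (* 41 is the least integer whose square, 1681, exceeds the 1648 of [carre_var]. *)
  have -> : (41 * (k * (N * s * r)) ^+ 2 / Num.sqrt N) ^+ 2 =
      1681 * k ^+ 4 * N ^+ 3 * s2 ^+ 2 * r ^+ 2 ^+ 2.
    rewrite -sE exprMn exprVn sqN; field; rewrite gt_eqF //.
  by rewrite !ler_wpM2r ?exprn_ge0 ?(ltW s2_gt0) ?(ltW k0) ?(ltW r_gt0) //; lra.
(* 1096 = 512 + 8 + 576, from 8^3, 16 / 2 and (9/2) 16^2 / 2; the fourth-power sum is absorbed
   because 576 m^2 + 384 m <= 576 (1 + m)^2. Multiplying by 4 and by N^2 / 2 edges yields 2192. *)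
have row_le e : `|b e| ^+ 3 + 2^-1 * (k * r * (s2 * \sum_g line_coef k e g ^+ 2) +
   (9 / 2 * (s2 * \sum_g line_coef k e g ^+ 2) ^+ 2 +
    3 * s2 * \sum_g line_coef k e g ^+ 4) / (k * r)) <= 1096 * k ^+ 3 * r ^+ 3.
  have V0 : 0 <= s2 * \sum_g line_coef k e g ^+ 2.
    by rewrite mulr_ge0 ?(ltW s2_gt0) // sumr_ge0 // => g _; rewrite sqr_ge0.
  have V1 : s2 * \sum_g line_coef k e g ^+ 2 <= 16 * k ^+ 2 * m.
    rewrite (_ : 16 * k ^+ 2 * m = s2 * (16 * k ^+ 2 * N)); last by rewrite /m; ring.
    by rewrite ler_wpM2l ?(ltW s2_gt0).
  have V2 : (s2 * \sum_g line_coef k e g ^+ 2) ^+ 2 <= (16 * k ^+ 2 * m) ^+ 2.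
    by rewrite lerXn2r ?nnegrE // (le_trans V0).
  have V4 : 3 * s2 * \sum_g line_coef k e g ^+ 4 <= 768 * k ^+ 4 * m.
    rewrite (_ : 768 * k ^+ 4 * m = 3 * s2 * (256 * k ^+ 4 * N)); last by rewrite /m; ring.
    by rewrite ler_wpM2l ?row4 // mulr_ge0 ?(ltW s2_gt0).
  have k3 : 0 <= k ^+ 3 by rewrite exprn_ge0 ?ltW.
  apply: (@le_trans _ _ ((8 * k) ^+ 3 + 2^-1 * (k * r * (16 * k ^+ 2 * m) +
     (9 / 2 * (16 * k ^+ 2 * m) ^+ 2 + 768 * k ^+ 4 * m) / (k * r)))).
    apply: lerD; first by rewrite lerXn2r ?nnegrE ?mulr_ge0 ?(ltW k0).
    rewrite ler_wpM2l ?invr_ge0 //; apply: lerD; first by rewrite ler_wpM2l // ltW.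
    rewrite ler_wpM2r ?invr_ge0 ?(ltW kr0) //; apply: lerD => //.
    by rewrite ler_wpM2l // divr_ge0.
  have -> : (8 * k) ^+ 3 + 2^-1 * (k * r * (16 * k ^+ 2 * m) +
      (9 / 2 * (16 * k ^+ 2 * m) ^+ 2 + 768 * k ^+ 4 * m) / (k * r)) =
      k ^+ 3 * (512 + 8 * (r * m) + (576 * m ^+ 2 + 384 * m) / r).
    by field; rewrite !gt_eqF.
  rewrite [X in _ <= X](_ : _ =
    k ^+ 3 * (512 * r ^+ 3 + 8 * r ^+ 3 + 576 * r ^+ 3)); last by ring.
  rewrite ler_wpM2l //; apply: lerD; first apply: lerD.
  - rewrite -[leLHS]mulr1; apply: ler_wpM2l; first exact: ler0n.
    exact: exprn_ege1.
  - rewrite ler_wpM2l // (exprS r 2) r2 ler_wpM2l ?(ltW r_gt0) //; lra.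
  - rewrite ler_pdivrMr // -mulrA -exprSr (exprM r 2 2) r2; nra.
apply: (@le_trans _ _ (4 * C * s2 * (N ^+ 2 / 2 * (1096 * k ^+ 3 * r ^+ 3)))).
  apply: ler_wpM2l; first by apply: mulr_ge0; [apply: mulr_ge0|exact: ltW].
  apply: (sum_edge_le _ row_le); apply: mulr_ge0; last by rewrite exprn_ge0 ?ltW.
  by apply: mulr_ge0; rewrite ?ler0n // exprn_ge0 ?ltW.
rewrite -sE le_eqVlt; apply/orP; left; apply/eqP.
by field; rewrite !gt_eqF.
Qed.

End line_graph_form.

(** * The Frobenius distance as a quadratic form in the edges *)

Section graph_code.
Context {n : nat}.
Implicit Types G H : sgraph n.

Lemma sgraph_sym G i j : G i j = G j i.
Proof. by have /andP[_ /forallP/(_ i)/forallP/(_ j)/eqP] := sgraph_adjP G. Qed.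

Lemma sgraph_irr G i : G i i = false.
Proof. by have /andP[/forallP/(_ i)/negbTE] := sgraph_adjP G. Qed.

Definition graph_code G : {ffun edge n -> bool} :=
  [ffun e => G (val e).1 (val e).2].

Lemma graph_code_inj : injective graph_code.
Proof.
move=> G H GH; apply: val_inj; apply/matrixP => i j.
have lt_eq (i' j' : 'I_n) : (i' < j')%N -> G i' j' = H i' j'.
  move=> ij; have e_in : (i', j') \in @edge_pred n by [].
  by have /ffunP/(_ (Sub (i', j') e_in)) := GH; rewrite !ffunE.
case: (ltngtP i j) => [/lt_eq //|/lt_eq|/val_inj ->].
  by rewrite -!/(sgraph_adj _ _ _) /= ![_ i j]sgraph_sym.
by rewrite /= !sgraph_irr.
Qed.

Lemma graph_code_surj (w : {ffun edge n -> bool}) : exists G, graph_code G = w.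
Proof.
pose low (i j : 'I_n) : bool := if insub (i, j) is Some e then w e else false.
pose A : 'M[bool]_n := \matrix_(i, j) (low i j || low j i).
have lowP i j : low i j -> (i < j)%N.
  rewrite /low; case: insubP => [e he ee _|//].
  by move: he; rewrite inE.
have AP : is_adjacency A.
  apply/andP; split; apply/forallP => i.
    by rewrite mxE orbb; apply/negP => /lowP; rewrite ltnn.
  by apply/forallP => j; rewrite !mxE orbC.
exists (SGraph AP); apply/ffunP => e; rewrite ffunE /= mxE.
have -> : low (val e).2 (val e).1 = false.
  have lt_e : ((val e).1 < (val e).2)%N by exact: (valP e).
  by apply/negP => /lowP /(ltn_trans lt_e); rewrite ltnn.
rewrite orbF /low; case: insubP => [e' _ ee'|].
  by congr (w _); apply: val_inj; rewrite ee' -surjective_pairing.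
by rewrite -surjective_pairing (valP e).
Qed.

End graph_code.

Section frobenius.
Context {R : realType} {n : nat}.
Implicit Types G H : sgraph n.

(** Expectations over graphs move to the cube, where one edge can be flipped independently of the
    others. *)
Lemma sum_gnp_code (p : R) (F : {ffun edge n -> bool} -> R) :
  \sum_G gnp_pmf p G * F (graph_code G) = bexp p F.
Proof.
have codeK : bijective (@graph_code n).
  pose g w := sval (cid (@graph_code_surj n w)).
  have gK w : graph_code (g w) = w by exact: (svalP (cid (graph_code_surj w))).
  by exists g => // G; apply: graph_code_inj; rewrite gK.
rewrite /bexp (reindex (@graph_code n)) /=; last exact: onW_bij.
apply: eq_bigr => G _; congr (_ * _); rewrite /gnp_pmf /bprod.
transitivity (\prod_(e : edge n) bernoulli_pmf p (G (val e).1 (val e).2)).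
  by rewrite -(big_sub (@edge_pred n) (fun u => bernoulli_pmf p (G u.1 u.2))).
by apply: eq_bigr => e _; rewrite ffunE.
Qed.

Lemma degreeE G k : (degree G k)%:R =
  \sum_(e : edge n) inc e k * (graph_code G e)%:R :> R.
Proof.
transitivity (\sum_j (G k j)%:R : R).
  rewrite /degree -sum1_card natr_sum big_mkcond /=; apply: eq_bigr => j _.
  by rewrite inE; case: (G k j).
rewrite -(@sum_inc_edge R n (fun i j => (G i j)%:R)).
- by apply: eq_bigr => e _; rewrite ffunE.
- by move=> i j; rewrite sgraph_sym.
- by rewrite sgraph_irr.
Qed.

(** The diagonal of the Laplacian carries the degrees, and every edge fills two off-diagonal
    entries. *)
Lemma frob_dist_sqr G H : frob_dist G H ^+ 2 =
  \sum_k ((degree G k)%:R - (degree H k)%:R) ^+ 2 +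
  2 * \sum_(e : edge n) ((graph_code G e)%:R - (graph_code H e)%:R) ^+ 2 :> R.
Proof.
rewrite /frob_dist sqr_sqrtr; last first.
  by apply: sumr_ge0 => i _; apply: sumr_ge0 => j _; rewrite sqr_ge0.
pose X (i j : 'I_n) : R := ((G i j)%:R - (H i j)%:R) ^+ 2.
have -> : \sum_(e : edge n) ((graph_code G e)%:R - (graph_code H e)%:R) ^+ 2 =
    \sum_(e : edge n) X (val e).1 (val e).2.
  by apply: eq_bigr => e _; rewrite !ffunE.
have -> : 2 * \sum_(e : edge n) X (val e).1 (val e).2 = \sum_i \sum_j X i j.
  transitivity (\sum_i \sum_(e : edge n) inc e i * X (val e).1 (val e).2).
    rewrite exchange_big mulr_sumr; apply: eq_bigr => e _ /=.
    by rewrite -mulr_suml sum_incV.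
  apply: eq_bigr => i _; apply: sum_inc_edge => [k l|].
    by rewrite /X ![_ k l]sgraph_sym.
  by rewrite /X !sgraph_irr subrr expr0n.
rewrite -big_split; apply: eq_bigr => i _ /=.
rewrite (bigD1 i) //= [in RHS](bigD1 i) //= addrA; congr (_ + _).
  by rewrite /X !mxE !sgraph_irr eqxx /=; ring.
apply: eq_bigr => j ji; rewrite !mxE [i == j]eq_sym (negbTE ji) !mulr0n /X.
by rewrite !sub0r -opprD sqrrN.
Qed.

Lemma frob_distC G H : frob_dist G H = frob_dist H G :> R.
Proof.
congr Num.sqrt; apply: eq_bigr => i _; apply: eq_bigr => j _.
by rewrite -sqrrN opprB.
Qed.

(** The coefficient 4 is 2 + 2: an edge adds to the variance of the degree at both its ends, and it
    is counted twice off the diagonal. *)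
Definition frob_mean (p : R) H : R :=
  \sum_k ((n%:R - 1) * p - (degree H k)%:R) ^+ 2 +
  4 * (p * (1 - p)) * \sum_(e : edge n) 1 +
  2 * \sum_(e : edge n) (p - (graph_code H e)%:R) ^+ 2.

(** The last term adds 4(p - h_e), from expanding (x_e + p - h_e)^2 with h_e the indicator in [H],
    to 4(1 - 2p), the linear part of the four squares x_e^2. *)
Definition frob_lin (p : R) H (e : edge n) : R :=
  2 * \sum_k inc e k * ((n%:R - 1) * p - (degree H k)%:R) +
  4 * (1 - p - (graph_code H e)%:R).

Lemma frob_dist_quad (p : R) G H : frob_dist G H ^+ 2 = frob_mean p H +
  quad p (frob_lin p H) (line_coef 1) (graph_code G).
Proof.
rewrite frob_dist_sqr; set w := graph_code G.
pose x e := cent p w e.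
have wE e : (w e)%:R = x e + p by rewrite /x /cent subrK.
pose d k : R := (n%:R - 1) * p - (degree H k)%:R.
have -> : \sum_k ((degree G k)%:R - (degree H k)%:R) ^+ 2 =
    \sum_k (\sum_e inc e k * x e + d k) ^+ 2.
  apply: eq_bigr => k _; congr (_ ^+ 2); rewrite degreeE -/w /d.
  under eq_bigr do rewrite wE mulrDr.
  by rewrite big_split /= -mulr_suml sum_incE; ring.
have -> : \sum_k (\sum_e inc e k * x e + d k) ^+ 2 =
    \sum_e x e * \sum_f overlap e f * x f +
    2 * \sum_e x e * \sum_k inc e k * d k + \sum_k d k ^+ 2.
  under eq_bigr do rewrite sqrrD.
  rewrite 2!big_split /=; congr (_ + _ + _).
    transitivity (\sum_k \sum_e \sum_f x e * (inc e k * inc f k * x f)).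
      apply: eq_bigr => k _; rewrite expr2 mulr_suml; apply: eq_bigr => e _.
      by rewrite mulr_sumr; apply: eq_bigr => f _; ring.
    rewrite exchange_big /=; apply: eq_bigr => e _.
    rewrite exchange_big /= mulr_sumr; apply: eq_bigr => f _.
    by rewrite -mulr_sumr mulr_suml.
  transitivity (\sum_k \sum_e 2 * (x e * (inc e k * d k))).
    apply: eq_bigr => k _; rewrite -mulr_natl mulr_suml mulr_sumr.
    by apply: eq_bigr => e _; ring.
  rewrite exchange_big mulr_sumr; apply: eq_bigr => e _ /=.
  by rewrite -mulr_sumr -mulr_sumr.
have -> : \sum_e x e * \sum_f overlap e f * x f =
    2 * \sum_e x e ^+ 2 + 2^-1 * \sum_e x e * linf p (line_coef 1 e) w.
  rewrite !mulr_sumr -big_split; apply: eq_bigr => e _ /=.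
  rewrite (bigD1 e) //= meetee /linf [in RHS](bigD1 e) //= line_coef_diag mul0r add0r.
  rewrite (eq_bigr (fun f => 2^-1 * (line_coef 1 e f * cent p w f))).
    by rewrite -mulr_sumr /x; ring.
  by move=> f; rewrite /line_coef eq_sym => /negbTE -> ; rewrite /x; field.
have -> : \sum_e ((w e)%:R - (graph_code H e)%:R) ^+ 2 = \sum_e x e ^+ 2 +
    2 * \sum_e x e * (p - (graph_code H e)%:R) + \sum_e (p - (graph_code H e)%:R) ^+ 2.
  rewrite mulr_sumr -!big_split; apply: eq_bigr => e _ /=.
  by rewrite wE; ring.
have -> : \sum_e x e ^+ 2 = (1 - 2 * p) * \sum_e x e + (p * (1 - p)) * \sum_(e : edge n) 1.
  rewrite !mulr_sumr -big_split; apply: eq_bigr => e _ /=.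
  by rewrite /x /cent; case: (w e) => /=; ring.
have linE : linf p (frob_lin p H) w = 2 * \sum_e x e * \sum_k inc e k * d k +
    4 * ((1 - 2 * p) * \sum_e x e) + 4 * \sum_e x e * (p - (graph_code H e)%:R).
  rewrite !mulr_sumr -!big_split; apply: eq_bigr => e _ /=.
  by rewrite /frob_lin -/(x e) -/(d _); ring.
rewrite /frob_mean /quad linE -/(d _).
by ring.
Qed.

End frobenius.

(** * Circulant regular graphs *)

Section regular_graph.

Lemma sum_interval_bool (n a b : nat) :
  (\sum_(t < n) ((a <= t) && (t < b)) = minn b n - minn a n)%N.
Proof.
elim: n => [|n IH]; first by rewrite big_ord0; lia.
by rewrite big_ord_recr /= IH; lia.
Qed.

Variables (n d : nat).
Hypothesis d_lt : (d < n.+1)%N.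
Hypothesis nd_even : ~~ odd (n.+1 * d).

(** Steps of length at most d/2 in both directions, and the antipode when [d] is odd; evenness of
    [n.+1 * d] guarantees that the antipode then exists. *)
Definition circ (t : 'I_n.+1) : bool :=
  [|| (0 < t <= d./2)%N, (n.+1 - d./2 <= t)%N | odd d && (t.*2 == n.+1)].

Lemma circN t : circ (- t) = circ t.
Proof.
rewrite /circ /=.
have := ltn_ord t; case: (posnP t) => [-> _|t0 tn].
  by rewrite subn0 modnn.
by rewrite modn_small ?ltn_subrL ?t0 //; lia.
Qed.

Lemma circ0 : circ 0 = false.
Proof. by rewrite /circ /=; lia. Qed.

Lemma card_circ : #|[set t | circ t]%SET| = d.
Proof.
have dE := odd_double_half d; have nE := odd_double_half n.+1.
have n_even : odd d -> odd n.+1 = false.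
  by move=> od; move: nd_even; rewrite oddM od andbT => /negbTE.
rewrite -sum1_card big_mkcond /=.
(* The connection set as three disjoint intervals, the antipode being an interval of length
   [odd d]. *)
transitivity (\sum_(t < n.+1) (((1 <= t) && (t < d./2.+1)) +
   (((n.+1 - d./2 <= t) && (t < n.+1)) +
   (((n.+1)./2 <= t) && (t < (n.+1)./2 + odd d))))%N)%N.
  apply: eq_bigr => t _; rewrite inE /circ; have := ltn_ord t.
  move: dE nE n_even d_lt; move: (n.+1)./2 (d./2) => m k.
  case: (odd d) => /= dE nE n_even dn tn.
    move: nE; rewrite n_even // => nE.
    case: (leqP 1 t) => t0; case: (leqP t k) => tk /=;
    case: (leqP (n.+1 - k) t) => nkt /=; case: (eqVneq t.*2 n.+1) => t2 /=; lia.
  by case: (leqP 1 t) => t0; case: (leqP t k) => tk /=;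
    case: (leqP (n.+1 - k) t) => nkt /=; lia.
rewrite !big_split /= !sum_interval_bool.
move: dE nE n_even d_lt; move: (n.+1)./2 (d./2) => m k.
case: (odd d) => /= dE nE n_even dn; last by lia.
by move: nE; rewrite n_even // => nE; lia.
Qed.

Lemma circ_adjacency : is_adjacency (\matrix_(i, j) circ (j - i)).
Proof.
apply/andP; split; apply/forallP => i; first by rewrite mxE subrr circ0.
by apply/forallP => j; rewrite !mxE -circN opprB.
Qed.

Lemma regular_graph_exists : exists H : sgraph n.+1, forall k, degree H k = d.
Proof.
exists (SGraph circ_adjacency) => k.
rewrite /degree -[RHS]card_circ.
rewrite -(card_imset _ (addIr (- k))) /=.
congr (#|pred_of_set _|); apply/setP => t; rewrite inE.
apply/imsetP/idP => [[j]|ct]; first by rewrite inE mxE => h ->.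
by exists (t + k); rewrite ?inE ?mxE addrK.
Qed.

End regular_graph.

(** * Expectation and cdf under the random graph law as finite sums *)

Section gnp_measure.
Context {R : realType} (n : nat) (p : R).
Hypothesis p01 : 0 <= p <= 1.

Lemma gnpE (A : set (sgraph n)) :
  gnp n p A = (\sum_(G | G \in A) gnp_pmf p G)%:E.
Proof.
rewrite /gnp p01.
rewrite fsbig_mkcond.
have E := @fsbigE _ _ _ _ _ _ (patch (fun=> 0%E) A (fun G => (gnp_pmf p G)%:E))
  (index_enum_uniq (sgraph n)).
rewrite (E _ _ setT) => [|//|G _]; last by rewrite mem_index_enum.
rewrite (eq_bigl xpredT) => [|G]; last by rewrite in_setT.
by rewrite /patch -big_mkcond sumEFin.
Qed.

Lemma expectation_gnp (f : sgraph n -> R) : (forall G, 0 <= f G) ->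
  ('E_(gnp n p)[f])%E = (\sum_G gnp_pmf p G * f G)%:E.
Proof.
move=> f0; rewrite unlock.
transitivity (\int[gnp n p]_G (\sum_(H : sgraph n) (f H * \1_[set H] G)%:E))%E.
  apply: eq_integral => G _; rewrite (bigD1 G) //= big1 => [|H HG].
    by rewrite adde0 indicE mem_set // mulr1.
  by rewrite indicE memNset ?mulr0 //= => /esym/eqP; apply/negP.
rewrite ge0_integral_sum //; last first.
  by move=> H G _; rewrite lee_fin mulr_ge0.
rewrite -sumEFin; apply: eq_bigr => H _.
under eq_integral do rewrite EFinM.
rewrite ge0_integralZl ?lee_fin //.
have pmfE : gnp n p [set H] = (gnp_pmf p H)%:E.
  rewrite gnpE (eq_bigl (pred1 H)) ?big_pred1_eq // => G.
  by apply/idP/eqP => [/set_mem|->] //; exact/mem_set.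
rewrite integral_indic // setIT [RHS]EFinM muleC; congr (_ * _)%E.
exact: pmfE.
Qed.

Lemma cdf_gnp (f : sgraph n -> R) (x : R) :
  cdf (sgraph_rv f : {RV gnp n p >-> R}) x =
  (\sum_(G | f G <= x) gnp_pmf p G)%:E.
Proof.
transitivity (gnp n p (f @^-1` `]-oo, x])); first by [].
rewrite gnpE; congr (_ %:E).
apply: eq_bigl => G; apply/idP/idP => [/set_mem|fx].
  by rewrite /= in_itv.
by apply/mem_set; rewrite /= in_itv.
Qed.

End gnp_measure.

(** * Expected squared distance and Fréchet means *)

Section frechet.
Context {R : realType} (n : nat) (p : R).
Hypothesis p01 : 0 <= p <= 1.

Lemma expectation_frob_dist (H : sgraph n) :
  ('E_(gnp n p)[fun K => (frob_dist H K ^+ 2)%R])%E = (frob_mean p H)%:E.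
Proof.
rewrite expectation_gnp // => [|G]; last by rewrite sqr_ge0.
congr (_ %:E).
transitivity (\sum_G gnp_pmf p G * (frob_mean p H +
  quad p (frob_lin p H) (line_coef 1) (graph_code G))).
  by apply: eq_bigr => G _; rewrite frob_distC (frob_dist_quad p).
rewrite (sum_gnp_code p (fun w => frob_mean p H + quad p (frob_lin p H) (line_coef 1) w)).
by rewrite bexpD bexp_cst bexp_quad ?addr0 // => e; exact: line_coef_diag.
Qed.

Lemma sum_degree (H : sgraph n) :
  \sum_k (degree H k)%:R = 2 * \sum_(e : edge n) (graph_code H e)%:R :> R.
Proof.
under eq_bigr do rewrite degreeE.
rewrite exchange_big mulr_sumr; apply: eq_bigr => e _ /=.
by rewrite -mulr_suml sum_incV.
Qed.

(** For a boolean indicator h, (p - h)^2 is affine in h, so the edge sum depends only on the number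
    of edges, hence on the degrees by the handshake identity. *)
Lemma frob_meanE (H : sgraph n) : frob_mean p H =
  n%:R * ((n%:R - 1) * p) ^+ 2 + 2 * n%:R * (n%:R - 1) * (p * (1 - p)) +
  n%:R * (n%:R - 1) * p ^+ 2 +
  \sum_k ((degree H k)%:R ^+ 2 - (2 * n%:R * p - 1) * (degree H k)%:R).
Proof.
rewrite /frob_mean sum_edge1.
have -> : \sum_(e : edge n) (p - (graph_code H e)%:R) ^+ 2 =
    p ^+ 2 * \sum_(e : edge n) 1 + (1 - 2 * p) * \sum_(e : edge n) (graph_code H e)%:R.
  rewrite !mulr_sumr -big_split; apply: eq_bigr => e _ /=.
  by case: (graph_code H e) => /=; ring.
have -> : \sum_(e : edge n) (graph_code H e)%:R = 2^-1 * \sum_k (degree H k)%:R :> R.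
  by rewrite sum_degree; field.
have -> : \sum_k ((n%:R - 1) * p - (degree H k)%:R) ^+ 2 =
    \sum_k (degree H k)%:R ^+ 2 - 2 * (n%:R - 1) * p * \sum_k (degree H k)%:R +
    n%:R * ((n%:R - 1) * p) ^+ 2.
  rewrite (_ : n%:R * _ = \sum_(k < n) ((n%:R - 1) * p) ^+ 2); last first.
    by rewrite sumr_const card_ord mulr_natl.
  rewrite mulr_sumr -sumrB -big_split; apply: eq_bigr => k _ /=.
  by ring.
rewrite sumrB -mulr_sumr sum_edge1.
by field.
Qed.

End frechet.

(** The parabola [psi] has its vertex at np - 1/2, whose unique nearest integer is [d] because d <
    np < d + 1. One vertex of another degree makes the sum strictly larger than for a [d]-regular
    graph. *)
Lemma frechet_mean_regular (R : realType) (n d : nat) (p : R) (M : sgraph n) :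
  0 <= p <= 1 -> (0 < n)%N -> d%:R < n%:R * p < d.+1%:R -> ~~ odd (n * d) -> (d < n)%N ->
  frechet_mean (gnp n p) M -> forall k, degree M k = d.
Proof.
move=> p01; case: n M => // n' M _ /andP[d_lt lt_d] nd dn minM k.
have [H Hd] := regular_graph_exists dn nd.
pose psi (x : nat) : R := x%:R ^+ 2 - (2 * n'.+1%:R * p - 1) * x%:R.
have E1 (x : nat) : psi x - psi d = (x%:R - d%:R) * (x%:R + d%:R + 1 - 2 * (n'.+1%:R * p)).
  by rewrite /psi; ring.
have psi_gt x : x != d -> psi d < psi x.
  rewrite -subr_gt0 E1 neq_ltn => /orP[xd|dx].
    have xd1 : x%:R + 1 <= d%:R :> R by rewrite natr1 ler_nat.
    by rewrite nmulr_rgt0; lra.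
  have dx1 : d%:R + 1 <= x%:R :> R by rewrite natr1 ler_nat.
  move: lt_d; rewrite -natr1 => lt_d.
  by rewrite pmulr_rgt0; lra.
have psi_ge x : psi d <= psi x.
  by case: (eqVneq x d) => [->//|/psi_gt/ltW].
apply/eqP; apply: contraT => Mk.
have := minM H.
rewrite !expectation_frob_dist // lee_fin !frob_meanE lerD2l leNgt => /negP; case.
rewrite (eq_bigr (fun=> psi d)) => [|i _]; last by rewrite Hd.
rewrite (bigD1 k) //= [ltRHS](bigD1 k) //=; apply: ltr_leD.
  exact: psi_gt.
by apply: ler_sum => i _; exact: psi_ge.
Qed.

Section moments.
Context {R : realType}.
Implicit Types N p t : R.

(* Mean and variance of the squared distance to a d-regular graph on N
   vertices, with t = N p - d.  Their invariance under (p, t) |-> (1 - p, 1 - t)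
   reflects that of the distance under complementation. *)
Definition mean_sq N p t : R :=
  3 * N ^+ 2 * (p * (1 - p)) - 2 * N * (p * (1 - p)) - N * (t * (1 - t)).

Definition var_sq N p t : R :=
  8 * (p * (1 - p)) * (N * (N - 1) * (1 + t - 2 * p) ^+ 2 +
    N * (N * p - t) * (4 * p - 1 - 2 * t)) +
  2 * (p * (1 - p)) ^+ 2 * (N * (N - 1) * (N - 2)).

Lemma mean_sqC N p t : mean_sq N (1 - p) (1 - t) = mean_sq N p t.
Proof. by rewrite /mean_sq; ring. Qed.

Lemma var_sqC N p t : var_sq N (1 - p) (1 - t) = var_sq N p t.
Proof. by rewrite /var_sq; ring. Qed.

End moments.

Lemma quadZ {R : realType} {n : nat} (p k : R) (b : edge n -> R) w :
  quad p (fun e => k * b e) (line_coef k) w = k * quad p b (line_coef 1) w.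
Proof.
have linZ (c d : edge n -> R) : (forall e, c e = k * d e) -> linf p c w = k * linf p d w.
  by move=> cd; rewrite /linf mulr_sumr; apply: eq_bigr => e _; rewrite cd mulrA.
rewrite /quad (linZ _ b) // mulrDr; congr (_ + _).
rewrite [RHS]mulrCA [in RHS]mulr_sumr; congr (_ * _); apply: eq_bigr => e _.
rewrite (linZ _ (line_coef 1 e)); first by rewrite mulrCA.
by move=> f; rewrite /line_coef; case: eqP => _; rewrite ?mulr0 //; ring.
Qed.

Section regular.
Context {R : realType} {n d : nat} (p : R) (M : sgraph n).
Local Notation N := (n%:R : R).
Local Notation s2 := (p * (1 - p)).
Local Notation t := (N * p - d%:R).
Hypothesis p01 : 0 < p < 1.
Hypothesis n_gt0 : (0 < n)%N.
Hypothesis M_reg : forall k, degree M k = d.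

Let sum_code : \sum_(e : edge n) (graph_code M e)%:R = N * d%:R / 2 :> R.
Proof.
have := sum_degree (R := R) M.
under eq_bigr do rewrite M_reg.
rewrite sumr_const card_ord -[_ *+ n]mulr_natl => ->; by field.
Qed.

Lemma frob_lin_regular e :
  frob_lin p M e = 4 * (1 + t - 2 * p - (graph_code M e)%:R).
Proof.
rewrite /frob_lin; under eq_bigr do rewrite M_reg.
by rewrite -mulr_suml sum_incV; ring.
Qed.

Lemma frob_mean_regular : frob_mean p M = mean_sq N p t.
Proof.
rewrite frob_meanE; under eq_bigr do rewrite M_reg.
by rewrite sumr_const card_ord -[_ *+ n]mulr_natl /mean_sq; ring.
Qed.

(** The square of [frob_lin] is affine in the edge indicator of [M], so only the number nd/2 of
    edges matters and not which regular graph is taken. *)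
Lemma frob_var_regular : quad_var p (frob_lin p M) (line_coef 1) = var_sq N p t.
Proof.
rewrite /quad_var sum_line_coef2.
have -> : \sum_e frob_lin p M e ^+ 2 = 16 * (1 + t - 2 * p) ^+ 2 * \sum_(e : edge n) 1 +
    16 * (4 * p - 1 - 2 * t) * \sum_(e : edge n) (graph_code M e)%:R.
  rewrite !mulr_sumr -big_split; apply: eq_bigr => e _ /=.
  by rewrite frob_lin_regular; case: (graph_code M e) => /=; ring.
by rewrite sum_code sum_edge1 /var_sq; field.
Qed.

Hypothesis t01 : 0 <= t <= 1.

Lemma frob_stein (f f' : R -> R) (C k rho : R) (P : sgraph n -> R) : 0 < k ->
  (forall G, P G = k * (frob_dist G M ^+ 2 - mean_sq N p t)) ->
  (forall x, `|f' x| <= C) ->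
  (forall x y, `|f y - f x - (y - x) * f' x| <= C * (y - x) ^+ 2) ->
  rho = k * (N * Num.sqrt s2 * Num.sqrt (1 + N * s2)) ->
  `|\sum_G gnp_pmf p G * (P G * f (P G)) -
    k ^+ 2 * var_sq N p t * \sum_G gnp_pmf p G * f' (P G)| <=
  C * (41 * rho ^+ 2 / Num.sqrt N + 2192 * rho ^+ 3 / (N * Num.sqrt s2)).
Proof.
move=> k0 PE0 f'C taylor rhoE.
pose b e := k * frob_lin p M e.
have PE G : P G = quad p b (line_coef k) (graph_code G).
  by rewrite PE0 (frob_dist_quad p) frob_mean_regular quadZ; ring.
under eq_bigr do rewrite PE.
rewrite (sum_gnp_code p (fun w => quad p b (line_coef k) w * f (quad p b (line_coef k) w))).
under [X in _ - _ * X]eq_bigr do rewrite PE.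
rewrite (sum_gnp_code p (fun w => f' (quad p b (line_coef k) w))).
have -> : k ^+ 2 * var_sq N p t = quad_var p b (line_coef k).
  rewrite -frob_var_regular /quad_var !sum_line_coef2.
  have -> : \sum_e b e ^+ 2 = k ^+ 2 * \sum_e frob_lin p M e ^+ 2.
    by rewrite mulr_sumr; apply: eq_bigr => e _; rewrite /b exprMn.
  by ring.
(* 1 + t - 2p minus the indicator lies between -2 and 2, which is the origin of the constant 8
   bounding [b]. *)
apply: line_stein => // e.
rewrite /b normrM gtr0_norm // mulrC ler_pM2r // frob_lin_regular.
case/andP: p01 => p0 p1; case/andP: t01 => t0 t1.
by rewrite ler_norml; case: (graph_code M e) => /=; apply/andP; split; lra.
Qed.

End regular.

(** * The central limit theorem *)

(** Both sides of F <= sqrt(m) + x tau are nonnegative and can be squared. The square of x tau,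
    divided by 2 sqrt(m) tau, is the displacement of the threshold. *)
Lemma frob_le_iff {R : realType} (F m tau x : R) :
  0 <= F -> 0 < m -> 0 < tau -> 0 <= Num.sqrt m + x * tau ->
  (F - Num.sqrt m <= x * tau) =
  ((2 * Num.sqrt m * tau)^-1 * (F ^+ 2 - m) <= x + x ^+ 2 * (tau / Num.sqrt m) / 2).
Proof.
move=> F0 m0 tau0; set r := Num.sqrt m => r0.
have r_gt0 : 0 < r by rewrite sqrtr_gt0.
have mE : m = r ^+ 2 by rewrite sqr_sqrtr // ltW.
rewrite [X in _ = (X <= _)]mulrC ler_pdivrMr ?mulr_gt0 // mE.
have -> : (x + x ^+ 2 * (tau / r) / 2) * (2 * r * tau) = (r + x * tau) ^+ 2 - r ^+ 2.
  by field; rewrite gt_eqF.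
by rewrite lerD2r lerBlDl ler_sqr ?nnegrE.
Qed.

Section finite_n.
Context {R : realType} {n d : nat} (p : R) (M : sgraph n).
Local Notation N := (n%:R : R).
Local Notation s2 := (p * (1 - p)).
Local Notation t := (N * p - d%:R).
Hypothesis p01 : 0 < p < 1.
Hypothesis n_gt0 : (0 < n)%N.
Hypothesis M_reg : forall k, degree M k = d.
Hypothesis t01 : 0 <= t <= 1.

(** [e1] pays for replacing the actual variance by its limit [v2], using that the mean of [f'] is at
    most [C] in absolute value; [e2] is the Stein error, with rho replaced by its upper bound
    [r0]. *)
Lemma frob_stein_bound (f f' : R -> R) (C k v2 r0 e1 e2 : R)
    (P : sgraph n -> R) : 0 < k ->
  (forall G, P G = k * (frob_dist G M ^+ 2 - mean_sq N p t)) -> 0 <= r0 ->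
  k ^+ 2 * (N ^+ 2 * s2 * (1 + N * s2)) <= r0 ^+ 2 ->
  `|k ^+ 2 * var_sq N p t - v2| <= e1 ->
  41 * r0 ^+ 2 / Num.sqrt N + 2192 * r0 ^+ 3 / Num.sqrt (N ^+ 2 * s2) <= e2 ->
  (forall x, `|f' x| <= C) ->
  (forall x y, `|f y - f x - (y - x) * f' x| <= C * (y - x) ^+ 2) ->
  `|\sum_G gnp_pmf p G * (P G * f (P G) - v2 * f' (P G))| <= C * (e1 + e2).
Proof.
move=> k0 PE r00 kr var_le rate_le f'C taylor.
have s2_gt0 : 0 < s2 by case/andP: p01 => ? ?; rewrite mulr_gt0 // subr_gt0.
have p01' : 0 <= p <= 1 by case/andP: p01 => ? ?; rewrite !ltW.
have N0 : 0 < N by rewrite ltr0n.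
have C0 : 0 <= C by exact: le_trans (f'C 0).
pose rho := k * (N * Num.sqrt s2 * Num.sqrt (1 + N * s2)).
have m0 : 0 <= 1 + N * s2 by rewrite addr_ge0 // mulr_ge0 // ltW.
have rho0 : 0 <= rho by rewrite mulr_ge0 ?(ltW k0) // !mulr_ge0 ?sqrtr_ge0 ?ltW.
have rho_le : rho <= r0.
  rewrite -(@ler_pXn2r _ 2) ?nnegrE //; apply: le_trans kr.
  by rewrite /rho !exprMn !sqr_sqrtr ?(ltW s2_gt0) // mulrA.
have := frob_stein p01 n_gt0 M_reg t01 k0 PE f'C taylor (erefl rho).
set T := \sum_G gnp_pmf p G * f' (P G); set U := \sum_G _ => H.
have T_le : `|T| <= C.
  apply: le_trans (ler_norm_sum _ _ _) _.
  rewrite -[C in leRHS]mul1r -(sum_gnp_pmf n p) mulr_suml; apply: ler_sum => G _.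
  by rewrite normrM ger0_norm ?gnp_pmf_ge0 // ler_wpM2l ?gnp_pmf_ge0.
have -> : \sum_G gnp_pmf p G * (P G * f (P G) - v2 * f' (P G)) =
    (U - k ^+ 2 * var_sq N p t * T) + (k ^+ 2 * var_sq N p t - v2) * T.
  rewrite (_ : _ + _ = U - v2 * T); last by ring.
  rewrite /U /T mulr_sumr -sumrB; apply: eq_bigr => G _.
  by rewrite mulrBr; congr (_ - _); rewrite mulrCA.
apply: le_trans (ler_normD _ _) _.
rewrite [leRHS]mulrDr [leRHS]addrC; apply: lerD; last first.
  by rewrite normrM mulrC; apply: ler_pM.
apply: le_trans H _; apply: ler_wpM2l => //; apply: le_trans rate_le.
have -> : N * Num.sqrt s2 = Num.sqrt (N ^+ 2 * s2).
  by rewrite [RHS]sqrtrM ?sqr_ge0 // sqrtr_sqr ger0_norm ?(ltW N0).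
apply: lerD.
  rewrite ler_wpM2r ?invr_ge0 ?sqrtr_ge0 // ler_wpM2l //.
  by rewrite lerXn2r ?nnegrE.
rewrite ler_wpM2r ?invr_ge0 ?sqrtr_ge0 //; apply: ler_wpM2l; first exact: ler0n.
by rewrite lerXn2r ?nnegrE.
Qed.

End finite_n.

(** As k^2 = (4 m tau^2)^-1, the lower bound with [kap] says rho^2 <= (4 kap)^-1, uniformly in n.
    The remaining hypotheses give, in turn, vanishing Stein error, the limit variance, and a
    vanishing displacement of the threshold. *)
Lemma frob_clt (R : realType) (N : set nat) (p t tau : nat -> R)
    (M : forall n, sgraph n) (v kap x : R) :
  (forall n, N n -> (0 < n)%N) ->
  (forall n, N n -> 0 < p n < 1) ->
  (forall n, N n -> 0 < tau n) ->
  (forall n, N n -> exists d : nat, [/\ t n = n%:R * p n - d%:R, 0 <= t n <= 1 &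
     forall k, degree (M n) k = d]) ->
  0 < v -> 0 < kap ->
  n%:R ^+ 2 * (p n * (1 - p n)) @[n --> within N \oo] --> +oo ->
  var_sq n%:R (p n) (t n) / (4 * (mean_sq n%:R (p n) (t n) * tau n ^+ 2))
    @[n --> within N \oo] --> v ^+ 2 ->
  (\forall n \near within N \oo,
    kap * (n%:R ^+ 2 * (p n * (1 - p n)) * (1 + n%:R * (p n * (1 - p n)))) <=
    mean_sq n%:R (p n) (t n) * tau n ^+ 2) ->
  tau n ^+ 2 / mean_sq n%:R (p n) (t n) @[n --> within N \oo] --> (0 : R) ->
  {for x, continuous (fun u : R => normal_prob 0 v `]-oo, u]%classic)} ->
  \sum_(G : sgraph n | frob_dist G (M n) - Num.sqrt (mean_sq n%:R (p n) (t n)) <= x * tau n)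
     gnp_pmf (p n) G @[n --> within N \oo] --> fine (normal_prob 0 v `]-oo, x]%classic).
Proof.
move=> N0 p01 tau0 M_reg v0 kap0 A_cvg var_cvg mean_ge tau_cvg cont.
apply/cvgrPdist_le => eps eps0.
have [C [eta [eta0 approx]]] := stein_cdf_approx v0 eps0 cont.
pose C' := `|C| + 1.
have C'0 : 0 < C' by rewrite ltr_wpDl.
pose r0 := Num.sqrt (4 * kap)^-1.
have r00 : 0 < r0 by rewrite sqrtr_gt0 invr_gt0 mulr_gt0.
have r0E : r0 ^+ 2 = (4 * kap)^-1 by rewrite sqr_sqrtr // invr_ge0 mulr_ge0 // ltW.
(* Three errors of size [e] occur, one from the variance and two from the Stein bound: 3 C' e = 3
   eta / 4. *)
pose e := eta / (4 * C'); have e0 : 0 < e by rewrite divr_gt0 ?mulr_gt0.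
pose K1 := 41 * r0 ^+ 2 / e; have K10 : 0 < K1.
  by apply: divr_gt0 => //; apply: mulr_gt0; [exact: ltr0n|exact: exprn_gt0].
have [c c0 cE] : exists2 c : R, 0 < c & c = 2192 by exists 2192; rewrite ?ltr0n.
pose K2 := c * r0 ^+ 3 / e.
have K20 : 0 < K2 by rewrite divr_gt0 // mulr_gt0 ?exprn_gt0.
(* Bounding tau / sqrt(m) by the first term keeps sqrt(m) + x tau nonnegative; by the second, the
   threshold moves by at most [eta]. *)
pose e3 := Num.min (`|x| + 1)^-1 (eta / (x ^+ 2 + 1)).
have x1 : 0 < `|x| + 1 by rewrite ltr_wpDl.
have x2 : 0 < x ^+ 2 + 1 by rewrite ltr_wpDl ?sqr_ge0.
have e30 : 0 < e3 by rewrite lt_min invr_gt0 x1 divr_gt0.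
near=> n.
have Nn : N n by near: n; exact: withinT.
have n_gt0 := N0 _ Nn; have p01n := p01 _ Nn; have taun := tau0 _ Nn.
have [d [tE t01 Mr]] := M_reg _ Nn; rewrite tE in t01.
set m := mean_sq _ _ _.
set s2 := p n * (1 - p n).
have s2_gt0 : 0 < s2 by case/andP: p01n => ? ?; rewrite mulr_gt0 // subr_gt0.
have Nr : 0 < n%:R :> R by rewrite ltr0n.
have D0 : 0 < n%:R ^+ 2 * s2 * (1 + n%:R * s2).
  apply: mulr_gt0; first by apply: mulr_gt0 => //; exact: exprn_gt0.
  by apply: addr_gt0 => //; exact: mulr_gt0.
have mean_gen : kap * (n%:R ^+ 2 * s2 * (1 + n%:R * s2)) <= m * tau n ^+ 2.
  rewrite /m /s2; near: n; exact: mean_ge.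
have mt0 : 0 < m * tau n ^+ 2 by apply: lt_le_trans mean_gen; rewrite mulr_gt0.
have m_gt0 : 0 < m by move: mt0; rewrite pmulr_lgt0 // exprn_gt0.
set r := Num.sqrt m; have r_gt0 : 0 < r by rewrite sqrtr_gt0.
have rE : r ^+ 2 = m by rewrite sqr_sqrtr // ltW.
pose k := (2 * r * tau n)^-1.
have k0 : 0 < k by rewrite invr_gt0 !mulr_gt0.
have kE : k ^+ 2 = (4 * (m * tau n ^+ 2))^-1.
  by rewrite /k -rE exprVn; congr (_^-1); ring.
have q0 : 0 <= tau n / r by rewrite divr_ge0 ?(ltW taun) ?(ltW r_gt0).
have tau_r : tau n / r <= e3.
  rewrite -(@ler_pXn2r _ 2) ?nnegrE ?divr_ge0 ?(ltW taun) ?(ltW r_gt0) ?(ltW e30) //.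
  rewrite expr_div_n rE.
  have : `|0 - tau n ^+ 2 / m| <= e3 ^+ 2.
    rewrite /m; near: n; move/cvgrPdist_le : tau_cvg; apply.
    by rewrite exprn_gt0.
  by rewrite sub0r normrN; apply: le_trans; exact: ler_norm.
have [e3a e3b] : e3 <= (`|x| + 1)^-1 /\ e3 <= eta / (x ^+ 2 + 1).
  by split; rewrite ge_min lexx ?orbT.
have pos : 0 <= r + x * tau n.
  have : tau n * (`|x| + 1) <= r.
    rewrite -ler_pdivlMr // -ler_pdivrMl // mulrC.
    exact: le_trans e3a.
  have := ler_norm (- x); rewrite normrN => h1 h2.
  have : - x * tau n <= `|x| * tau n by rewrite ler_wpM2r // ltW.
  by lra.
rewrite distrC.
pose P G := k * (frob_dist G (M n) ^+ 2 - m).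
rewrite (eq_bigl (fun G : sgraph n => P G <= x + x ^+ 2 * (tau n / r) / 2)); last first.
  by move=> G; rewrite frob_le_iff //; exact: sqrtr_ge0.
have p01' : 0 <= p n <= 1 by case/andP: p01n => ? ?; rewrite !ltW.
apply: approx.
- by move=> G; exact: gnp_pmf_ge0.
- exact: sum_gnp_pmf.
- rewrite addrAC subrr add0r ger0_norm; last first.
    by rewrite divr_ge0 ?ler0n // mulr_ge0 ?sqr_ge0.
  apply: (@le_trans _ _ (x ^+ 2 * (tau n / r))).
    have : 0 <= x ^+ 2 * (tau n / r) by rewrite mulr_ge0 ?sqr_ge0.
    by lra.
  apply: (@le_trans _ _ ((x ^+ 2 + 1) * (eta / (x ^+ 2 + 1)))).
    by apply: ler_pM; rewrite ?sqr_ge0 ?lerDl // (le_trans tau_r).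
  by rewrite mulrC divfK // gt_eqF.
- move=> f f' f'C taylor.
  have f'C' y : `|f' y| <= C'.
    by apply: le_trans (f'C y) _; apply: le_trans (ler_norm _) _; rewrite lerDl.
  have taylor' y z : `|f z - f y - (z - y) * f' y| <= C' * (z - y) ^+ 2.
    apply: le_trans (taylor y z) _; rewrite ler_wpM2r ?sqr_ge0 //.
    by apply: le_trans (ler_norm _) _; rewrite lerDl.
  have h1 : k ^+ 2 * (n%:R ^+ 2 * s2 * (1 + n%:R * s2)) <= r0 ^+ 2.
    have mt4 : 0 < 4 * (m * tau n ^+ 2) by apply: mulr_gt0; rewrite ?ltr0n.
    rewrite kE r0E ler_pdivrMl // (_ : _ / _ = m * tau n ^+ 2 / kap).
      by rewrite ler_pdivlMr // mulrC.
    by field; rewrite gt_eqF.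
  have h2 : `|k ^+ 2 * var_sq n%:R (p n) (n%:R * p n - d%:R) - v ^+ 2| <= e.
    rewrite kE mulrC -tE distrC.
    by rewrite /m; near: n; move/cvgrPdist_le : var_cvg; apply.
  have h3 : 41 * r0 ^+ 2 / Num.sqrt n%:R + 2192 * r0 ^+ 3 / Num.sqrt (n%:R ^+ 2 * s2)
      <= e + e.
    rewrite -cE; apply: lerD.
      rewrite ler_pdivrMr ?sqrtr_gt0 // -ler_pdivrMl // mulrC -/K1.
      rewrite -(@ger0_norm _ K1) ?(ltW K10) // -sqrtr_sqr ler_wsqrtr //.
      near: n; apply: cvg_within; exact: nbhs_infty_ger.
    rewrite ler_pdivrMr ?sqrtr_gt0 ?(mulr_gt0 _ s2_gt0) ?exprn_gt0 //.
    rewrite -ler_pdivrMl // mulrC -/K2.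
    rewrite -(@ger0_norm _ K2) ?(ltW K20) // -sqrtr_sqr ler_wsqrtr //.
    by rewrite /s2; near: n; move/cvgryPge : A_cvg; apply.
  have PE G : P G = k * (frob_dist G (M n) ^+ 2 - mean_sq n%:R (p n) (n%:R * p n - d%:R)).
    by rewrite /P /m tE.
  have := frob_stein_bound p01n n_gt0 Mr t01 k0 PE (ltW r00) h1 h2 h3 f'C' taylor'.
  move/le_trans; apply.
  have -> : C' * (e + (e + e)) = 3 / 4 * eta by rewrite /e; field; rewrite gt_eqF.
  by rewrite ger_pMl // ler_pdivrMr // mul1r ler_nat.
Unshelve. all: by end_near. Qed.

(** * Asymptotics of the first two moments *)

Section limits.
Context {R : realType} {F : set_system nat} {FF : Filter F}.
Implicit Types f g : nat -> R.

Lemma near_cvg_to f g (l l' : R) : f n @[n --> F] --> l -> l = l' ->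
  (\forall n \near F, f n = g n) -> g n @[n --> F] --> l'.
Proof. by move=> fl <- fg; apply: cvg_trans fl; exact: near_eq_cvg. Qed.

Lemma cvg_sqr f (l : R) : f n @[n --> F] --> l -> f n ^+ 2 @[n --> F] --> l ^+ 2.
Proof. by move=> fl; apply: (near_cvg_to (cvgM fl fl)) => //; exact: nearW. Qed.

Lemma cvg0_le f g : (\forall n \near F, `|f n| <= g n) ->
  g n @[n --> F] --> (0 : R) -> f n @[n --> F] --> (0 : R).
Proof.
move=> fg g0; apply: norm_cvg0; apply: squeeze_cvgr (cvg_cst 0) g0.
by near=> n; rewrite normr_ge0 /=; near: n.
Unshelve. all: by end_near. Qed.

Lemma near_cvg_ge f (l b : R) : f n @[n --> F] --> l -> b < l ->
  \forall n \near F, b <= f n.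
Proof.
move=> fl bl; have e0 : 0 < l - b by rewrite subr_gt0.
move/cvgrPdist_le : fl => /(_ _ e0); apply: filterS => n.
by rewrite ler_norml => /andP[_]; lra.
Qed.

Lemma near_cvg_le f (l b : R) : f n @[n --> F] --> l -> l < b ->
  \forall n \near F, f n <= b.
Proof.
move=> fl lb; have e0 : 0 < b - l by rewrite subr_gt0.
move/cvgrPdist_le : fl => /(_ _ e0); apply: filterS => n.
by rewrite ler_norml => /andP[+ _]; lra.
Qed.

Lemma cvg_inv_pinfty f : (\forall n \near F, 0 < f n) ->
  f n @[n --> F] --> +oo -> (f n)^-1 @[n --> F] --> (0 : R).
Proof. by move=> f0 /(gtr0_cvgV0 f0). Qed.

Variables q y : nat -> R.
Local Notation s n := (q n * (1 - q n)).
Local Notation N n := (n%:R : R).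
Local Notation m n := (N n * s n).
Local Notation A n := (N n ^+ 2 * s n).
Local Notation mean n := (mean_sq (N n) (q n) (y n)).
Local Notation var n := (var_sq (N n) (q n) (y n)).

Hypothesis n_near : \forall n \near F, 1 <= N n.
Hypothesis q_near : \forall n \near F, 0 < q n <= 2^-1.
Hypothesis inv_cvg : (N n)^-1 @[n --> F] --> (0 : R).

(** For the regimes with constant normalization: [1 ^+ 2] stands for [tau n ^+ 2] in the hypotheses
    of [frob_clt]. *)
Lemma mean_ge_cvg0 (kap : R) : 0 < kap -> A n @[n --> F] --> +oo ->
  (\forall n \near F, kap * (A n * (1 + m n)) <= mean n * 1 ^+ 2) ->
  1 ^+ 2 / mean n @[n --> F] --> (0 : R).
Proof.
move=> kap0 Ay mean_ge.
have A0 : \forall n \near F, 0 < A n.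
  near=> n.
  have n1 : 1 <= N n by near: n.
  have /andP[q0 q1] : 0 < q n <= 2^-1 by near: n.
  by rewrite mulr_gt0 ?exprn_gt0 ?(lt_le_trans _ n1) // mulr_gt0 //; lra.
have h : kap^-1 * (A n)^-1 @[n --> F] --> (0 : R).
  by rewrite -(mulr0 kap^-1); apply: cvgM; [exact: cvg_cst|exact: cvg_inv_pinfty].
apply: cvg0_le h; near=> n.
have n1 : 1 <= N n by near: n.
have /andP[q0 q1] : 0 < q n <= 2^-1 by near: n.
have An : 0 < A n by near: n.
have m0 : 0 <= m n by rewrite mulr_ge0 // ?mulr_ge0 //; lra.
have : kap * (A n * (1 + m n)) <= mean n * 1 ^+ 2 by near: n.
rewrite expr1n mulr1 => h1.
have h2 : kap * A n <= mean n.
  by apply: le_trans h1; rewrite ler_pM2l // ler_peMr ?(ltW An) // lerDl.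
have kA : 0 < kap * A n by rewrite mulr_gt0.
have mean0 : 0 < mean n by exact: lt_le_trans h2.
by rewrite div1r gtr0_norm ?invr_gt0 // -invfM lef_pV2 ?posrE // mulrC.
Unshelve. all: by end_near. Qed.

Section finite_limit.
Variable c : R.
Hypothesis m_cvg : m n @[n --> F] --> c.

(** Since q <= 1/2, q <= 2 q (1 - q) = 2 m / n. For p itself the limit could equally be 1. *)
Lemma q_cvg0 : q n @[n --> F] --> (0 : R).
Proof.
have h : 2 * m n * (N n)^-1 @[n --> F] --> (0 : R).
  rewrite -[X in _ --> X](mulr0 (2 * c)).
  by apply: cvgM => //; apply: cvgM => //; exact: cvg_cst.
apply: cvg0_le h; near=> n.
have n1 : 1 <= N n by near: n.
have /andP[q0 q1] : 0 < q n <= 2^-1 by near: n.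
rewrite gtr0_norm // (_ : _ / _ = 2 * s n); first by nra.
by field; rewrite gt_eqF // (lt_le_trans _ n1).
Unshelve. all: by end_near. Qed.

Let onem_q_cvg : 1 - q n @[n --> F] --> (1 : R).
Proof.
by rewrite -[X in _ --> X]subr0; apply: cvgB; [exact: cvg_cst|exact: q_cvg0].
Qed.

Lemma x_cvg : N n * q n @[n --> F] --> c.
Proof.
have h : m n * (1 - q n)^-1 @[n --> F] --> c * 1^-1.
  by apply: cvgM => //; apply: cvgV => //; exact: oner_neq0.
apply: (near_cvg_to h); first by rewrite invr1 mulr1.
near=> n; have /andP[q0 q1] : 0 < q n <= 2^-1 by near: n.
by field; rewrite gt_eqF //; lra.
Unshelve. all: by end_near. Qed.

End finite_limit.

Let cst (a : R) : (fun=> a) @ F --> a. Proof. exact: cvg_cst. Qed.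

Let inv1 : 1 - (N n)^-1 @[n --> F] --> (1 : R).
Proof. by rewrite -[X in _ --> X]subr0; exact: cvgB. Qed.

Let inv2 : 1 - 2 * (N n)^-1 @[n --> F] --> (1 : R).
Proof.
rewrite -[X in _ --> X]subr0 -[X in _ --> _ - X](mulr0 2).
by apply: cvgB => //; exact: cvgM.
Qed.

(** Here nq - y = 0, so the second term of the linear variance drops out. The mean is equivalent to
    2 n^2 q and the variance to 8 n^2 q; the ratio is 8 / (4 * 2) = 1. *)
Lemma sparse_limits : (\forall n \near F, y n = N n * q n) ->
  m n @[n --> F] --> (0 : R) ->
  var n / (4 * (mean n * 1 ^+ 2)) @[n --> F] --> (1 : R) ^+ 2 /\
  (\forall n \near F, 1 * (A n * (1 + m n)) <= mean n * 1 ^+ 2).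
Proof.
move=> yE m0.
have q0 := q_cvg0 m0; have x0 := x_cvg m0.
have onemq : 1 - q n @[n --> F] --> (1 : R).
  by rewrite -[X in _ --> X]subr0; exact: cvgB.
pose mu n := 3 * (1 - q n) - 2 * (1 - q n) * (N n)^-1 - (1 - N n * q n).
have mu_cvg : mu n @[n --> F] --> (2 : R).
  rewrite (_ : 2 = 3 * 1 - 2 * 1 * 0 - (1 - 0)); last by ring.
  apply: cvgB; last exact: cvgB.
  by apply: cvgB; [exact: cvgM|apply: cvgM => //; exact: cvgM].
pose nu n := 8 * (1 - q n) * (1 - (N n)^-1) * (1 + N n * q n - 2 * q n) ^+ 2 +
  2 * (N n * q n) * (1 - q n) ^+ 2 * ((1 - (N n)^-1) * (1 - 2 * (N n)^-1)).
have nu_cvg : nu n @[n --> F] --> (8 : R).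
  rewrite (_ : 8 =
    8 * 1 * 1 * (1 + 0 - 2 * 0) ^+ 2 + 2 * 0 * 1 ^+ 2 * (1 * 1)); last by ring.
  apply: cvgD; apply: cvgM.
  - by apply: cvgM => //; exact: cvgM.
  - by apply: cvg_sqr; apply: cvgB; [exact: cvgD|exact: cvgM].
  - by apply: cvgM; [exact: cvgM|exact: cvg_sqr].
  - exact: cvgM.
have meanE : \forall n \near F, mean n = N n * (N n * q n) * mu n.
  near=> n; have n1 : 1 <= N n by near: n.
  rewrite /mean_sq /mu (_ : y n = N n * q n); last by near: n.
  by field; rewrite gt_eqF // (lt_le_trans _ n1).
have varE : \forall n \near F, var n = N n * (N n * q n) * nu n.
  near=> n; have n1 : 1 <= N n by near: n.
  rewrite /var_sq /nu (_ : y n = N n * q n); last by near: n.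
  by field; rewrite gt_eqF // (lt_le_trans _ n1).
split.
  have h : nu n * (4 * mu n)^-1 @[n --> F] --> (8 * (4 * 2)^-1 : R).
    by apply: cvgM => //; apply: cvgV; [rewrite mulf_neq0|exact: cvgM].
  apply: (near_cvg_to h); first by field.
  have mu1 : \forall n \near F, 1 <= mu n by apply: near_cvg_ge mu_cvg _; lra.
  near=> n.
  have n1 : 1 <= N n by near: n.
  have /andP[qn0 q1] : 0 < q n <= 2^-1 by near: n.
  rewrite (_ : mean n = N n * (N n * q n) * mu n); last by near: n.
  rewrite (_ : var n = N n * (N n * q n) * nu n); last by near: n.
  have mun : 1 <= mu n by near: n.
  have mun0 : 0 < mu n by exact: lt_le_trans mun.
  have n0 : 0 < N n by exact: lt_le_trans n1.
  by field; rewrite !gt_eqF.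
(* [mu] tends to 2, while (1 - q)(1 + m) is eventually at most 5/4. *)
have mu5 : \forall n \near F, 5 / 4 <= mu n by apply: near_cvg_ge mu_cvg _; lra.
have m4 : \forall n \near F, m n <= 4^-1 by apply: near_cvg_le m0 _; lra.
near=> n.
have n1 : 1 <= N n by near: n.
have /andP[qn0 q1] : 0 < q n <= 2^-1 by near: n.
rewrite (_ : mean n = N n * (N n * q n) * mu n); last by near: n.
have mun : 5 / 4 <= mu n by near: n.
have mn : m n <= 4^-1 by near: n.
have n0 : 0 < N n by exact: lt_le_trans n1.
have X0 : 0 < N n * (N n * q n) by rewrite !mulr_gt0.
rewrite mul1r expr1n mulr1.
rewrite (_ : A n * (1 + m n) = N n * (N n * q n) * ((1 - q n) * (1 + m n))); last by ring.
rewrite ler_pM2l //; apply: le_trans mun.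
have mge : 0 <= m n by rewrite mulr_ge0 ?mulr_ge0 ?(ltW qn0) ?(ltW n0) //; lra.
by move: mge mn; move: (m n) => z; nra.
Unshelve. all: by end_near. Qed.

(** Mean and variance are both of order n. [D] is the limit 3c - (c-k)(1-(c-k)) of mean / n in
    expanded form; the correction proportional to nq - y = k disappears after division by n. *)
Lemma critical_limits (c k : R) : 0 < c -> 0 <= k -> k < c < k + 1 ->
  (\forall n \near F, y n = N n * q n - k) ->
  m n @[n --> F] --> c ->
  let D := (c - k) ^+ 2 + k + 2 * c in
  var n / (4 * (mean n * 1 ^+ 2)) @[n --> F] -->
    c * (4 * (c - k + 1) ^+ 2 + c) / (2 * D) /\
  (\forall n \near F, D / (4 * (c + 1) * (c + 2)) * (A n * (1 + m n)) <= mean n * 1 ^+ 2).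
Proof.
move=> c0 k0 /andP[kc ck] yE mc D.
have D0 : 0 < D by rewrite /D; have := sqr_ge0 (c - k); lra.
have q0 := q_cvg0 mc; have xc := x_cvg mc.
have yc : y n @[n --> F] --> c - k.
  have h : N n * q n - k @[n --> F] --> c - k by exact: cvgB.
  by apply: (near_cvg_to h) => //; near=> n; apply/esym; near: n.
pose mu n := 3 * m n - 2 * m n * (N n)^-1 - y n * (1 - y n).
have mu_cvg : mu n @[n --> F] --> D.
  rewrite (_ : D = 3 * c - 2 * c * 0 - (c - k) * (1 - (c - k))); last by rewrite /D; ring.
  apply: cvgB; last by apply: cvgM => //; exact: cvgB.
  by apply: cvgB; [exact: cvgM|apply: cvgM => //; exact: cvgM].
pose nu n := 8 * m n * ((1 - (N n)^-1) * (1 + y n - 2 * q n) ^+ 2 +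
    k * (N n)^-1 * (4 * q n - 1 - 2 * y n)) +
  2 * m n ^+ 2 * ((1 - (N n)^-1) * (1 - 2 * (N n)^-1)).
have nu_cvg : nu n @[n --> F] --> 8 * c * (1 + (c - k)) ^+ 2 + 2 * c ^+ 2.
  rewrite (_ : 8 * c * _ + _ = 8 * c * (1 * (1 + (c - k) - 2 * 0) ^+ 2 +
    k * 0 * (4 * 0 - 1 - 2 * (c - k))) + 2 * c ^+ 2 * (1 * 1)); last by ring.
  apply: cvgD; apply: cvgM.
  - exact: cvgM.
  - apply: cvgD; apply: cvgM => //.
    + by apply: cvg_sqr; apply: cvgB; [exact: cvgD|exact: cvgM].
    + exact: cvgM.
    + by apply: cvgB; [apply: cvgB => //; exact: cvgM|exact: cvgM].
  - by apply: cvgM => //; exact: cvg_sqr.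
  - exact: cvgM.
have meanE : \forall n \near F, mean n = N n * mu n.
  near=> n; have n1 : 1 <= N n by near: n.
  rewrite /mean_sq /mu.
  by field; rewrite gt_eqF // (lt_le_trans _ n1).
have varE : \forall n \near F, var n = N n * nu n.
  near=> n; have n1 : 1 <= N n by near: n.
  have yn : y n = N n * q n - k by near: n.
  rewrite /var_sq /nu (_ : N n * q n - y n = k); last by rewrite yn; ring.
  by field; rewrite gt_eqF // (lt_le_trans _ n1).
have muD : \forall n \near F, D / 2 <= mu n.
  by apply: near_cvg_ge mu_cvg _; lra.
split.
  have h : nu n * (4 * mu n)^-1 @[n --> F] -->
      (8 * c * (1 + (c - k)) ^+ 2 + 2 * c ^+ 2) * (4 * D)^-1.
    apply: cvgM => //; apply: cvgV; last exact: cvgM.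
    by rewrite mulf_neq0 ?gt_eqF.
  apply: (near_cvg_to h); first by field; rewrite gt_eqF.
  near=> n.
  have n1 : 1 <= N n by near: n.
  rewrite (_ : mean n = N n * mu n); last by near: n.
  rewrite (_ : var n = N n * nu n); last by near: n.
  have mun : D / 2 <= mu n by near: n.
  have mun0 : 0 < mu n by apply: lt_le_trans mun; rewrite divr_gt0.
  have n0 : 0 < N n by exact: lt_le_trans n1.
  by field; rewrite !gt_eqF.
(* Then m (1 + m) <= (c + 1)(c + 2), so the chosen constant leaves at most D/4, below the eventual
   lower bound D/2 of [mu]. *)
have m1 : \forall n \near F, m n <= c + 1 by apply: near_cvg_le mc _; lra.
near=> n.
have n1 : 1 <= N n by near: n.
have n0 : 0 < N n by exact: lt_le_trans n1.
have /andP[qn0 q1] : 0 < q n <= 2^-1 by near: n.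
rewrite (_ : mean n = N n * mu n); last by near: n.
have mun : D / 2 <= mu n by near: n.
have mn : m n <= c + 1 by near: n.
have mge : 0 <= m n by rewrite mulr_ge0 ?mulr_ge0 ?(ltW qn0) ?(ltW n0) //; lra.
rewrite expr1n mulr1 (_ : A n * _ = N n * (m n * (1 + m n))); last by ring.
rewrite mulrCA ler_pM2l //; apply: le_trans mun.
have mm : m n * (1 + m n) <= (c + 1) * (c + 2).
  by apply: ler_pM => //; lra.
have cc : 0 < (c + 1) * (c + 2) by apply: mulr_gt0; lra.
apply: (@le_trans _ _ (D / (4 * (c + 1) * (c + 2)) * ((c + 1) * (c + 2)))).
  by rewrite ler_wpM2l // divr_ge0 ?(ltW D0) //; lra.
rewrite -[4 * _ * _]mulrA invfM -!mulrA mulVf ?gt_eqF // mulr1.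
by rewrite ler_pM2l //; lra.
Unshelve. all: by end_near. Qed.

(** The mean is equivalent to 3 n m and the variance to 2 n m^2, so with tau^2 = m the ratio is 2 /
    (4 * 3). No limit of [q] or [y] is available, only bounds. *)
Lemma dense_limits (tau : nat -> R) : (\forall n \near F, 0 <= y n <= 1) ->
  (\forall n \near F, 0 <= N n * q n - y n <= N n) ->
  (\forall n \near F, tau n ^+ 2 = m n) ->
  m n @[n --> F] --> +oo ->
  [/\ var n / (4 * (mean n * tau n ^+ 2)) @[n --> F] --> (1 / 6 : R),
  (\forall n \near F, 1 * (A n * (1 + m n)) <= mean n * tau n ^+ 2),
  tau n ^+ 2 / mean n @[n --> F] --> (0 : R) &
  A n @[n --> F] --> +oo].
Proof.
move=> y01 dn tauE my.
have m1 : \forall n \near F, 1 <= m n by move/cvgryPge : my; exact.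
have minv : (m n)^-1 @[n --> F] --> (0 : R).
  apply: cvg_inv_pinfty => //; near=> n; apply: (@lt_le_trans _ _ 1) => //.
  by near: n.
pose mu n := 3 - 2 * (N n)^-1 - y n * (1 - y n) * (m n)^-1.
have mu_cvg : mu n @[n --> F] --> (3 : R).
  rewrite (_ : 3 = 3 - 2 * 0 - 0); last by ring.
  apply: cvgB; first by apply: cvgB => //; exact: cvgM.
  apply: cvg0_le minv; near=> n.
  have /andP[y0 y1] : 0 <= y n <= 1 by near: n.
  have mn : 1 <= m n by near: n.
  have mi : 0 <= (m n)^-1 by rewrite invr_ge0 (le_trans _ mn).
  rewrite ger0_norm; last by rewrite mulr_ge0 // mulr_ge0 // subr_ge0.
  by rewrite ler_piMl //; nra.
(* The contribution of the linear part, bounded by 4 + 3 and negligible after division by [m]: the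
   quadratic part alone produces 1/6. *)
pose X n := (1 - (N n)^-1) * (1 + y n - 2 * q n) ^+ 2 +
  (N n)^-1 * (N n * q n - y n) * (4 * q n - 1 - 2 * y n).
have X7 : \forall n \near F, `|X n| <= 7.
  near=> n.
  have n1 : 1 <= N n by near: n.
  have n0 : 0 < N n by exact: lt_le_trans n1.
  have /andP[qn0 q1] : 0 < q n <= 2^-1 by near: n.
  have /andP[y0 y1] : 0 <= y n <= 1 by near: n.
  have /andP[d0 d1] : 0 <= N n * q n - y n <= N n by near: n.
  have i0 : 0 <= (N n)^-1 by rewrite invr_ge0 ltW.
  have i1 : (N n)^-1 <= 1 by rewrite invf_le1.
  apply: le_trans (ler_normD _ _) _; rewrite (_ : 7 = 1 * 4 + 1 * 3); last by ring.
  apply: lerD; rewrite normrM; apply: ler_pM => //.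
  - by rewrite ger0_norm; lra.
  - by rewrite ger0_norm ?sqr_ge0 //; nra.
  - rewrite ger0_norm; last by rewrite mulr_ge0.
    by rewrite mulrC ler_pdivrMr // mul1r.
  - by rewrite ler_norml; apply/andP; split; lra.
pose nu n := 2 * ((1 - (N n)^-1) * (1 - 2 * (N n)^-1)) + 8 * X n * (m n)^-1.
have nu_cvg : nu n @[n --> F] --> (2 : R).
  rewrite (_ : 2 = 2 * (1 * 1) + 0); last by ring.
  apply: cvgD; first by apply: cvgM => //; exact: cvgM.
  have h : 56 * (m n)^-1 @[n --> F] --> (0 : R).
    by rewrite -[X in _ --> X](mulr0 56); exact: cvgM.
  apply: cvg0_le h; near=> n.
  have mn : 1 <= m n by near: n.
  have Xn : `|X n| <= 7 by near: n.
  have mi : 0 <= (m n)^-1 by rewrite invr_ge0 (le_trans _ mn).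
  rewrite !normrM (ger0_norm mi) ler_wpM2r // ger0_norm //.
  by rewrite (_ : 56 = 8 * 7) ?ler_pM2l //; ring.
have meanE : \forall n \near F, mean n = A n * mu n.
  near=> n; have n1 : 1 <= N n by near: n.
  have /andP[qn0 q1] : 0 < q n <= 2^-1 by near: n.
  have n0 : 0 < N n by exact: lt_le_trans n1.
  have q2 : 0 < 1 - q n by lra.
  by rewrite /mean_sq /mu; field; rewrite !gt_eqF.
have varE : \forall n \near F, var n = A n * m n * nu n.
  near=> n; have n1 : 1 <= N n by near: n.
  have /andP[qn0 q1] : 0 < q n <= 2^-1 by near: n.
  have n0 : 0 < N n by exact: lt_le_trans n1.
  have q2 : 0 < 1 - q n by lra.
  by rewrite /var_sq /nu /X; field; rewrite !gt_eqF.
have mu2 : \forall n \near F, 2 <= mu n by apply: near_cvg_ge mu_cvg _; lra.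
have A0 : \forall n \near F, 0 < A n.
  near=> n.
  have n1 : 1 <= N n by near: n.
  have n0 : 0 < N n by exact: lt_le_trans n1.
  have /andP[qn0 q1] : 0 < q n <= 2^-1 by near: n.
  by rewrite mulr_gt0 ?exprn_gt0 // mulr_gt0 //; lra.
split.
- have h : nu n * (4 * mu n)^-1 @[n --> F] --> (2 * (4 * 3)^-1 : R).
    apply: cvgM => //; apply: cvgV; last exact: cvgM.
    by rewrite mulf_neq0.
  apply: (near_cvg_to h); first by field.
  near=> n.
  rewrite (_ : tau n ^+ 2 = m n); last by near: n.
  rewrite (_ : mean n = A n * mu n); last by near: n.
  rewrite (_ : var n = A n * m n * nu n); last by near: n.
  have mun : 2 <= mu n by near: n.
  have An : 0 < A n by near: n.
  have mn : 1 <= m n by near: n.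
  have mun0 : 0 < mu n by exact: lt_le_trans mun.
  have mn0 : 0 < m n by exact: lt_le_trans mn.
  move: An mn0; move: (A n) (m n) => a b a0 b0.
  by field; rewrite !gt_eqF.
- near=> n.
  rewrite (_ : tau n ^+ 2 = m n); last by near: n.
  rewrite (_ : mean n = A n * mu n); last by near: n.
  have mun : 2 <= mu n by near: n.
  have An : 0 < A n by near: n.
  have mn : 1 <= m n by near: n.
  rewrite mul1r -[leRHS]mulrA ler_pM2l //.
  by move: mn; move: (m n) => b b1; nra.
- have h : (N n)^-1 * (mu n)^-1 @[n --> F] --> (0 * 3^-1 : R).
    by apply: cvgM => //; exact: cvgV.
  apply: (near_cvg_to h); first by rewrite mul0r.
  near=> n.
  have n1 : 1 <= N n by near: n.
  have /andP[qn0 q1] : 0 < q n <= 2^-1 by near: n.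
  rewrite (_ : tau n ^+ 2 = m n); last by near: n.
  rewrite (_ : mean n = A n * mu n); last by near: n.
  have mun : 2 <= mu n by near: n.
  have mun0 : 0 < mu n by exact: lt_le_trans mun.
  have n0 : 0 < N n by exact: lt_le_trans n1.
  have q2 : 0 < 1 - q n by lra.
  by field; rewrite !gt_eqF.
- apply/cvgryPge => a; near=> n.
  have n1 : 1 <= N n by near: n.
  have mn : 1 <= m n by near: n.
  have : a <= m n by near: n; move/cvgryPge : my; exact.
  move=> am; apply: (le_trans am).
  rewrite (_ : A n = N n * m n); last by ring.
  by rewrite ler_peMl // (le_trans _ mn).
Unshelve. all: by end_near. Qed.

End limits.

(** * Complementation and the degree of a Fréchet mean *)

Section reduction.
Context {R : realType}.

Definition frac_part (x : R) : R := x - (Num.floor x)%:~R.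

Lemma frac_part_itv (x : R) : x \isn't a Num.int -> 0 < frac_part x < 1.
Proof.
move=> xZ; have /andP[fx] := floor_itv x; rewrite intrD => xf.
apply/andP; split; last by rewrite /frac_part; lra.
by rewrite subr_gt0 lt_neqAle fx andbT -intrEfloor.
Qed.

(** For non-integer x the floor of n - x is n - floor(x) - 1. *)
Lemma frac_part_natB (n : nat) (x : R) : x \isn't a Num.int -> frac_part (n%:R - x) = 1 - frac_part x.
Proof.
move=> xZ; have /andP[f0 f1] := frac_part_itv xZ.
rewrite {1}/frac_part (@floor_def _ _ (n%:Z - Num.floor x - 1)).
  by rewrite !intrB /= /frac_part; ring.
rewrite subrK !intrB /=; move: f0 f1; rewrite /frac_part => f0 f1.
rewrite -[n%:~R]/(n%:R).
by apply/andP; split; lra.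
Qed.

(** Complementing a graph preserves the distance and exchanges p with 1 - p, hence frac(np) with 1 -
    frac(np). The moments can thus be evaluated at the smaller of the two probabilities. *)
Lemma complement_reduction (n : nat) (p : R) : 0 < p < 1 -> n%:R * p \isn't a Num.int ->
  let q := Num.min p (1 - p) in
  [/\ 0 < q <= 2^-1, q * (1 - q) = p * (1 - p),
      mean_sq n%:R p (frac_part (n%:R * p)) = mean_sq n%:R q (frac_part (n%:R * q)) &
      var_sq n%:R p (frac_part (n%:R * p)) = var_sq n%:R q (frac_part (n%:R * q))].
Proof.
move=> /andP[p0 p1] npZ /=; have [pq|qp] := leP p (1 - p).
  by split=> //; rewrite p0 /=; lra.
have -> : frac_part (n%:R * (1 - p)) = 1 - frac_part (n%:R * p).
  by rewrite mulrBr mulr1 frac_part_natB.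
by split; [apply/andP; split; lra|ring|rewrite mean_sqC|rewrite var_sqC].
Qed.

Lemma frechet_degree (n : nat) (p : R) (M : sgraph n) :
  (0 < n)%N -> 0 < p < 1 -> n%:R * p \isn't a Num.int ->
  (2 %| n%:Z * Num.floor (n%:R * p))%Z -> frechet_mean (gnp n p) M ->
  exists d : nat, [/\ frac_part (n%:R * p) = n%:R * p - d%:R,
    0 <= frac_part (n%:R * p) <= 1 & forall k, degree M k = d].
Proof.
move=> n0 p01 npZ + minM; have /andP[f0 f1] := frac_part_itv npZ.
have /andP[p0 p1] := p01.
have nr : 0 < n%:R :> R by rewrite ltr0n.
have : 0 <= Num.floor (n%:R * p) by rewrite floor_ge0 mulr_ge0 // ltW.
move: f0 f1; rewrite /frac_part; case: (Num.floor _) => // d.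
rewrite -[(Posz d)%:~R]/(d%:R) => f0 f1 _ even.
exists d; split=> //; first by rewrite !ltW.
apply: (frechet_mean_regular _ _ _ _ _ minM) => //.
- by rewrite !ltW.
- by rewrite -natr1; apply/andP; split; lra.
- by move: even; rewrite dvdzE abszM /= dvdn2.
- rewrite -(ltr_nat R); apply: (@lt_trans _ _ (n%:R * p)); first by lra.
  by rewrite -[ltRHS]mulr1 ltr_pM2l.
Qed.

End reduction.

(** * From the moment limits to convergence in distribution *)

Section assembly.
Context {R : realType} (N : set nat) (p : nat -> R) (M : forall n : nat, sgraph n).
Hypothesis N2 : forall n, N n -> (2 <= n)%N.
Hypothesis p01 : forall n, N n -> 0 < p n < 1.
Hypothesis npZ : forall n, N n -> n%:R * p n \isn't a Num.int.
Hypothesis nd_even : forall n, N n -> (2 %| n%:Z * Num.floor (n%:R * p n))%Z.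
Hypothesis minM : forall n, N n -> frechet_mean (gnp n (p n)) (M n).

Let q n := Num.min (p n) (1 - p n).
Let y n := frac_part (n%:R * q n).

Let N0 n : N n -> (0 < n)%N. Proof. by move/N2/ltnW. Qed.

Let regM n (Nn : N n) := frechet_degree (N0 Nn) (p01 Nn) (npZ Nn) (nd_even Nn) (minM Nn).

Lemma root_mean_sq n : N n ->
  Num.sqrt (fine ('E_(gnp n (p n))[fun G => (frob_dist G (M n) ^+ 2)%R])%E) =
  Num.sqrt (mean_sq n%:R (p n) (frac_part (n%:R * p n))).
Proof.
move=> Nn; have [d [tE _ reg]] := regM Nn.
have p01' : 0 <= p n <= 1 by case/andP: (p01 Nn) => ? ?; rewrite !ltW.
rewrite (_ : (fun G => _) = (fun G => frob_dist (M n) G ^+ 2)); last first.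
  by apply/funext => G; rewrite frob_distC.
by rewrite expectation_frob_dist //= (frob_mean_regular _ reg) tE.
Qed.

(** The asymptotic hypotheses are stated with [q] and [y], where limits are computable, and are
    carried back to [p], under which the graphs are sampled. *)
Lemma cvg_in_distribution_frob (tau : nat -> R) (v kap : R)
    (X : forall n, sgraph n -> R) :
  (forall n, N n -> 0 < tau n) -> 0 < v -> 0 < kap ->
  (forall n, N n -> forall G x, (X n G <= x) =
     (frob_dist G (M n) -
      Num.sqrt (mean_sq n%:R (p n) (frac_part (n%:R * p n))) <= x * tau n)) ->
  n%:R ^+ 2 * (q n * (1 - q n)) @[n --> within N \oo] --> +oo ->
  var_sq n%:R (q n) (y n) / (4 * (mean_sq n%:R (q n) (y n) * tau n ^+ 2))
    @[n --> within N \oo] --> v ^+ 2 ->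
  (\forall n \near within N \oo,
    kap * (n%:R ^+ 2 * (q n * (1 - q n)) * (1 + n%:R * (q n * (1 - q n)))) <=
    mean_sq n%:R (q n) (y n) * tau n ^+ 2) ->
  tau n ^+ 2 / mean_sq n%:R (q n) (y n) @[n --> within N \oo] --> (0 : R) ->
  cvg_in_distribution N (fun n => sgraph_rv (X n) : {RV (gnp n (p n)) >-> R})
    (normal_prob 0 v).
Proof.
move=> tau0 v0 kap0 XE Ay var_cvg mean_ge tau_cvg x cont.
have side n (Nn : N n) := complement_reduction (p01 Nn) (npZ Nn).
have clt := @frob_clt R N p (fun n => frac_part (n%:R * p n)) tau M v kap x N0 p01 tau0
  (fun n Nn => regM Nn) v0 kap0.
have {}clt : \sum_(G : sgraph n | X n G <= x) gnp_pmf (p n) G @[n --> within N \oo]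
    --> fine (normal_prob 0 v `]-oo, x]%classic).
  have NN : \forall n \near within N \oo, N n by exact: withinT.
  apply: (near_cvg_to (clt _ _ _ _ cont)) => //.
  - apply: cvg_trans Ay; apply: near_eq_cvg; near=> n.
    by have [|_ -> _ _] := side n; first by near: n.
  - apply: near_cvg_to var_cvg _ _ => //; near=> n.
    by have [|_ _ -> ->] := side n; first by near: n.
  - near=> n; have [|_ <- -> _] := side n; first by near: n.
    by near: n.
  - apply: near_cvg_to tau_cvg _ _ => //; near=> n.
    by have [|_ _ -> _] := side n; first by near: n.
  - near=> n; apply: eq_bigl => G; rewrite XE //; by near: n.
rewrite -[X in _ --> X]fineK ?fin_num_measure //.
apply: cvg_trans (_ : (\sum_(G : sgraph n | X n G <= x) gnp_pmf (p n) G)%:E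
   @[n --> within N \oo] --> _); last first.
  by apply: cvg_EFin => //; exact: nearW.
apply: near_eq_cvg; near=> n.
rewrite cdf_gnp //.
have : 0 < p n < 1 by apply: p01; near: n; exact: withinT.
by case/andP => ? ?; rewrite !ltW.
Unshelve. all: by end_near. Qed.

End assembly.

Theorem theorem3 (R : realType) (N : set nat) (p : nat -> R)
    (M : forall n : nat, sgraph n) :
  infinite_set N ->
  (forall n, N n -> (2 <= n)%N) ->
  (forall n, N n -> 0 < p n < 1) ->
  (forall n, N n -> n%:R * p n \isn't a Num.int) ->
  (forall n, N n -> (2 %| n%:Z * Num.floor (n%:R * p n))%Z) ->
  (forall n, N n -> frechet_mean (gnp n (p n)) (M n)) ->
  let F n (G : sgraph n) : R := frob_dist G (M n) in
  let rootEF2 n : R :=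
    Num.sqrt (fine ('E_(gnp n (p n))[fun G => (F n G ^+ 2)%R])%E) in
  [/\ (n%:R * p n * (1 - p n) @[n --> within N \oo] --> (0 : R) ->
       n%:R ^+ 2 * p n * (1 - p n) @[n --> within N \oo] --> +oo ->
       cvg_in_distribution N
         (fun n => sgraph_rv (fun G => F n G - rootEF2 n)
            : {RV (gnp n (p n)) >-> R})
         (normal_prob 0 1)),
      (forall c : R, 0 < c -> c \isn't a Num.int ->
       n%:R * p n * (1 - p n) @[n --> within N \oo] --> c ->
       let fc : R := (Num.floor c)%:~R in
       cvg_in_distribution N
         (fun n => sgraph_rv (fun G => F n G - rootEF2 n)
            : {RV (gnp n (p n)) >-> R})
         (normal_prob 0 (Num.sqrt
            (c * (4 * (c - fc + 1) ^+ 2 + c) /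
             (2 * ((c - fc) ^+ 2 + fc + 2 * c)))))) &
      (n%:R * p n * (1 - p n) @[n --> within N \oo] --> +oo ->
       cvg_in_distribution N
         (fun n => sgraph_rv (fun G =>
              (F n G - rootEF2 n) / Num.sqrt (n%:R * p n * (1 - p n)))
            : {RV (gnp n (p n)) >-> R})
         (normal_prob 0 (Num.sqrt (1 / 6))))].
Proof.
move=> infN N2 p01 npZ nd_even minM F rootEF2.
pose q n := Num.min (p n) (1 - p n).
have N0 n : N n -> (0 < n)%N by move/N2/ltnW.
have side n (Nn : N n) := complement_reduction (p01 n Nn) (npZ n Nn).
have rootE n : N n -> rootEF2 n = Num.sqrt (mean_sq n%:R (p n) (frac_part (n%:R * p n))).
  exact: (@root_mean_sq R N p M N2 p01 npZ nd_even minM n).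
have NN : \forall n \near within N \oo, N n by exact: withinT.
have n_near : \forall n \near within N \oo, 1 <= n%:R :> R.
  by near=> n; rewrite ler1n N0 //; near: n.
have q_near : \forall n \near within N \oo, 0 < q n <= 2^-1.
  by near=> n; have [|] := side n; first by near: n.
have inv_cvg : (n%:R : R)^-1 @[n --> within N \oo] --> (0 : R).
  apply: cvg_inv_pinfty; first by apply: filterS n_near => n; exact: lt_le_trans.
  by apply: cvg_within_filter; exact: cvgr_idn.
have mE : \forall n \near within N \oo, n%:R * p n * (1 - p n) = n%:R * (q n * (1 - q n)).
  near=> n; have [|_ -> _ _] := side n; first by near: n.
  by rewrite mulrA.
have AE : \forall n \near within N \oo,
    n%:R ^+ 2 * p n * (1 - p n) = n%:R ^+ 2 * (q n * (1 - q n)).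
  near=> n; have [|_ -> _ _] := side n; first by near: n.
  by rewrite mulrA.
have X1 n : N n -> forall G x, (F n G - rootEF2 n <= x) =
    (frob_dist G (M n) - Num.sqrt (mean_sq n%:R (p n) (frac_part (n%:R * p n))) <= x * 1).
  by move=> Nn G x; rewrite rootE // mulr1.
split.
- move=> m0 A1.
  have {}m0 : n%:R * (q n * (1 - q n)) @[n --> within N \oo] --> (0 : R).
    exact: near_cvg_to m0 erefl mE.
  have {}A1 : n%:R ^+ 2 * (q n * (1 - q n)) @[n --> within N \oo] --> +oo.
    by apply: cvg_trans A1; exact: near_eq_cvg.
  have x0 : n%:R * q n @[n --> within N \oo] --> (0 : R).
    exact: (@x_cvg R (within N \oo) _ q n_near q_near inv_cvg 0 m0).
  (* nq tends to 0 and is eventually at most 1/2, so its floor is 0. *)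
  have yE : \forall n \near within N \oo, frac_part (n%:R * q n) = n%:R * q n.
    have x1 : \forall n \near within N \oo, n%:R * q n <= 2^-1.
      by apply: near_cvg_le x0 _; rewrite invr_gt0.
    near=> n.
    rewrite /frac_part (@floor_def _ _ 0) ?subr0 // add0r.
    have n1 : 1 <= n%:R :> R by near: n.
    have /andP[q0 _] : 0 < q n <= 2^-1 by near: n.
    rewrite mulr_ge0 ?(ltW q0) ?ler0n //=.
    apply: (@le_lt_trans _ _ 2^-1); last by rewrite invf_lt1 ?ltr1n.
    by near: n.
  have [var_cvg mean_ge] :=
    @sparse_limits R (within N \oo) _ q _ n_near q_near inv_cvg yE m0.
  apply: (@cvg_in_distribution_frob R N p M N2 p01 npZ nd_even minM
    (fun=> 1) 1 1) => //.
  exact: (@mean_ge_cvg0 R (within N \oo) _ q _ n_near q_near _ _ _ mean_ge).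
- move=> c c0 cZ mc fc.
  have {}mc : n%:R * (q n * (1 - q n)) @[n --> within N \oo] --> c.
    exact: near_cvg_to mc erefl mE.
  have /andP[f0 f1] := frac_part_itv cZ.
  have fc0 : 0 <= fc by rewrite /fc ler0z floor_ge0 ltW.
  have fcc : fc < c < fc + 1.
    by move: f0 f1; rewrite /frac_part -/fc => f0 f1; apply/andP; split; lra.
  have xc : n%:R * q n @[n --> within N \oo] --> c.
    exact: (@x_cvg R (within N \oo) _ q n_near q_near inv_cvg c mc).
  (* As [c] is not an integer, it lies strictly between [fc] and [fc + 1], and the floor of nq is
     eventually [fc]. The midpoint of [c] and [fc + 1] turns a large inequality into the strict one
     needed. *)
  have yE : \forall n \near within N \oo, frac_part (n%:R * q n) = n%:R * q n - fc.
    have /andP[fc1 fc2] := fcc.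
    have x1 : \forall n \near within N \oo, fc <= n%:R * q n by exact: near_cvg_ge xc fc1.
    have x2 : \forall n \near within N \oo, n%:R * q n <= (c + (fc + 1)) / 2.
      by apply: near_cvg_le xc _; lra.
    near=> n; rewrite /frac_part /fc; congr (_ - _%:~R).
    apply: floor_def; rewrite intrD -/fc; apply/andP; split; first by near: n.
    apply: (@le_lt_trans _ _ ((c + (fc + 1)) / 2)); last by lra.
    by near: n.
  have [var_cvg mean_ge] :=
    @critical_limits R (within N \oo) _ q _ n_near q_near inv_cvg c fc c0 fc0 fcc yE mc.
  have D0 : 0 < (c - fc) ^+ 2 + fc + 2 * c by have := sqr_ge0 (c - fc); lra.
  have v0 : 0 < c * (4 * (c - fc + 1) ^+ 2 + c) / (2 * ((c - fc) ^+ 2 + fc + 2 * c)).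
    rewrite divr_gt0 ?mulr_gt0 //; have := sqr_ge0 (c - fc + 1); lra.
  have kap0 : 0 < ((c - fc) ^+ 2 + fc + 2 * c) / (4 * (c + 1) * (c + 2)).
    by rewrite divr_gt0 // !mulr_gt0 //; lra.
  (* n^2 q (1 - q) is n times a quantity that is eventually at least c/2. *)
  have Ay : n%:R ^+ 2 * (q n * (1 - q n)) @[n --> within N \oo] --> +oo.
    have m2 : \forall n \near within N \oo, c / 2 <= n%:R * (q n * (1 - q n)).
      by apply: near_cvg_ge mc _; lra.
    apply/cvgryPge => a; near=> n.
    have n1 : 1 <= n%:R :> R by near: n.
    have mn : c / 2 <= n%:R * (q n * (1 - q n)) by near: n.
    have na : a / (c / 2) <= n%:R by near: n; apply: cvg_within; exact: nbhs_infty_ger.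
    rewrite expr2 -mulrA.
    move: na; rewrite ler_pdivrMr ?divr_gt0 // => /le_trans; apply.
    by rewrite ler_wpM2l.
  apply: (@cvg_in_distribution_frob R N p M N2 p01 npZ nd_even minM
    (fun=> 1) _ _ _ _ _ kap0) => //.
  + by rewrite sqrtr_gt0.
  + by rewrite sqr_sqrtr ?(ltW v0).
  + exact: (@mean_ge_cvg0 R (within N \oo) _ q _ n_near q_near _ _ _ mean_ge).
- move=> my.
  have {}my : n%:R * (q n * (1 - q n)) @[n --> within N \oo] --> +oo.
    by apply: cvg_trans my; exact: near_eq_cvg.
  pose tau n := Num.sqrt (n%:R * p n * (1 - p n)).
  have m_gt0 n : N n -> 0 < n%:R * p n * (1 - p n).
    by move=> Nn; have /andP[p0 p1] := p01 n Nn; rewrite !mulr_gt0 ?ltr0n ?N0 ?subr_gt0.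
  have tauE : \forall n \near within N \oo, tau n ^+ 2 = n%:R * (q n * (1 - q n)).
    near=> n; rewrite sqr_sqrtr; first by near: n.
    by rewrite ltW // m_gt0 //; near: n.
  (* If q = 1 - p, then nq = n - np is an integer only if np is. *)
  have xZ n : N n -> n%:R * q n \isn't a Num.int.
    move=> Nn; rewrite /q; case: leP => _; first exact: npZ.
    apply: contra (npZ n Nn) => h.
    rewrite (_ : _ * _ = n%:R - n%:R * (1 - p n)); last by ring.
    by rewrite rpredB // natr_int.
  have y01 : \forall n \near within N \oo, 0 <= frac_part (n%:R * q n) <= 1.
    near=> n; have /andP[f0 f1] : 0 < frac_part (n%:R * q n) < 1.
      by apply: frac_part_itv; apply: xZ; near: n.
    by rewrite !ltW.
  have dn : \forall n \near within N \oo, 0 <= n%:R * q n - frac_part (n%:R * q n) <= n%:R.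
    near=> n; have n1 : 1 <= n%:R :> R by near: n.
    have /andP[q0 q1] : 0 < q n <= 2^-1 by near: n.
    have nq0 : 0 <= n%:R * q n by rewrite mulr_ge0 ?(ltW q0) ?ler0n.
    rewrite /frac_part subKr ler0z floor_ge0 nq0 /=.
    apply: le_trans (floor_le _) _; rewrite ler_piMr ?ler0n //.
    by apply: le_trans q1 _; rewrite invf_le1 ?ler1n.
  have [var_cvg mean_ge tau_cvg Ay] :=
    @dense_limits R (within N \oo) _ q _ n_near q_near inv_cvg tau y01 dn tauE my.
  apply: (@cvg_in_distribution_frob R N p M N2 p01 npZ nd_even minM
    tau (Num.sqrt (1 / 6)) 1) => //.
  + by move=> n Nn; rewrite sqrtr_gt0 m_gt0.
  + by move=> n Nn G x; rewrite rootE // ler_pdivrMr // sqrtr_gt0 m_gt0.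
  + by rewrite sqr_sqrtr ?divr_ge0.
Unshelve. all: by end_near. Qed.
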